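(* Let $k$ be a field, let $(R,\mathfrak m)$ be a regular local ring of Krull dimension $n$ containing $k$ with residue field $k$, let $w\in\mathfrak m$ be non-zero and $S=R/w$. Assume that $(R,w)$ has isolated singular locus, i.e. there are $k$-linear derivations $\partial_1,\dots,\partial_n$ of $R$ with $\dim_k S/(\partial_1 w,\dots,\partial_n w)<\infty$. Consider the residue field $k$ as an $S$-module. Then its stabilization $k^{\mathrm{stab}}$ is a compact generator of the triangulated category $[\operatorname{MF}^\infty(R,w)]$.
   Context: $\operatorname{MF}^\infty(R,w)$ is the differential $\mathbb Z/2$-graded category whose objects are pairs $(X,d)$ with $X=X^0\oplus X^1$ a $\mathbb Z/2$-graded free $R$-module of possibly infinite rank and $d$ an odd $R$-linear endomorphism with $d^2=w\,\mathrm{id}_X$; the morphism complex $\operatorname{MF}(X,X')$ is the $\mathbb Z/2$-graded module of $R$-linear maps with differential $d(f)=d_{X'}\circ f-(-1)^{|f|}f\circ d_X$. $\operatorname{MF}(R,w)$ is the full subcategory of finite rank objects. $[\,\cdot\,]$ denotes the homotopy category, obtained by applying $H^0$ to morphism complexes; it is triangulated. Stabilization: there are equivalences $[\operatorname{MF}(R,w)]\simeq\underline{\mathrm{MCM}}(S)\simeq D^b(S)/D^b_{\mathrm{perf}}(S)$, where $\underline{\mathrm{MCM}}(S)$ is the stable category of maximal Cohen-Macaulay $S$-modules, the first functor is $(X^1\xrightarrow{\varphi}X^0\xrightarrow{\psi}X^1)\mapsto\operatorname{coker}(\varphi)$ and the second is the obvious one. For a finitely generated $S$-module $L$, $L^{\mathrm{stab}}$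 is the matrix factorization corresponding to $L$ viewed as an object of $D^b(S)/D^b_{\mathrm{perf}}(S)$. Explicitly, if $x_1,\dots,x_n$ is a regular sequence generating $\mathfrak m$ and $w=\sum x_iw_i$, then $k^{\mathrm{stab}}=(\bigoplus_{i}\bigwedge^i R^n,\ s_0+s_1)$ with $s_0$ contraction with $(x_1,\dots,x_n)$ and $s_1$ exterior multiplication by $(w_1,\dots,w_n)$. In a triangulated category $\mathcal T$ with infinite coproducts, $X$ is compact if $\operatorname{Hom}(X,-)$ commutes with infinite coproducts; $X$ is a generator if the smallest triangulated subcategory containing $X$ and closed under coproducts and isomorphisms is $\mathcal T$. *)

(* Defs.v *)
From HB Require Import structures.
From mathcomp Require Import all_boot all_order all_algebra.

Set Implicit Arguments.
Unset Strict Implicit.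
Unset Printing Implicit Defensive.

Import GRing.Theory.
Local Open Scope ring_scope.

(* Ideals are boolean predicates, as in ring_quotient; [idealr_closed] includes
   properness.  Under classical logic with choice this covers all (proper)
   ideals. *)

Definition ideal_span (R : comNzRingType) (p : nat) (P : pred 'I_p)
    (x : 'I_p -> R) (r : R) : Prop :=
  exists a : 'I_p -> R, r = \sum_(i | P i) a i * x i.

Definition generates (R : comNzRingType) (p : nat) (x : 'I_p -> R)
    (I : {pred R}) : Prop :=
  forall r, r \in I <-> ideal_span predT x r.

Definition noetherian (R : comNzRingType) : Prop :=
  forall I : {pred R}, idealr_closed I ->
    exists (p : nat) (x : 'I_p -> R), generates x I.

Definition maximal_ideal (R : comNzRingType) (m : {pred R}) : Prop :=
  idealr_closed m /\
  forall I : {pred R}, idealr_closed I -> {subset m <= I} -> I =i m.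

Definition local_ring (R : comNzRingType) (m : {pred R}) : Prop :=
  maximal_ideal m /\ forall m' : {pred R}, maximal_ideal m' -> m' =i m.

Definition prime_chain (R : comNzRingType) (l : nat)
    (p : 'I_l.+1 -> {pred R}) : Prop :=
  (forall i, idealr_closed (p i) /\ prime_idealr_closed (p i)) /\
  forall i j : 'I_l.+1, (i < j)%N -> {subset p i <= p j} /\ ~ (p i =i p j).

Definition krull_dim (R : comNzRingType) (n : nat) : Prop :=
  (exists p : 'I_n.+1 -> {pred R}, prime_chain p) /\
  forall (l : nat) (p : 'I_l.+1 -> {pred R}), prime_chain p -> (l <= n)%N.

Definition regular_local_ring (R : comNzRingType) (m : {pred R}) (n : nat) :
    Prop :=
  [/\ noetherian R, local_ring m, krull_dim R n
    & exists x : 'I_n -> R, generates x m].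

Definition has_residue_field (k : fieldType) (R : comAlgType k)
    (m : {pred R}) : Prop :=
  forall r : R, exists c : k, r - c%:A \in m.

Definition regular_sequence (R : comNzRingType) (n : nat) (x : 'I_n -> R) :
    Prop :=
  (forall (i : 'I_n) (r : R),
     ideal_span (fun j : 'I_n => (j < i)%N) x (x i * r) ->
     ideal_span (fun j : 'I_n => (j < i)%N) x r) /\
  ~ ideal_span predT x 1.

Definition derivation (k : fieldType) (R : comAlgType k)
    (D : {linear R -> R}) : Prop :=
  forall a b : R, D (a * b) = D a * b + a * D b.

(* dim_k R/(w, D_1 w, ..., D_n w) < oo: finitely many elements b_j of R span
   the quotient over k. *)
Definition finite_tjurina (k : fieldType) (R : comAlgType k) (w : R) (n : nat)
    (D : 'I_n -> {linear R -> R}) : Prop :=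
  exists (d : nat) (b : 'I_d -> R), forall r : R,
    exists (c : 'I_d -> k) (a0 : R) (a : 'I_n -> R),
      r = \sum_j c j *: b j + (a0 * w + \sum_i a i * D i w).

Definition isolated_singular_locus (k : fieldType) (R : comAlgType k) (w : R)
    (n : nat) : Prop :=
  exists D : 'I_n -> {linear R -> R},
    (forall i, derivation (D i)) /\ finite_tjurina w D.

Definition free_module (R : comNzRingType) (V : lmodType R) : Prop :=
  exists (I : choiceType) (e : I -> V),
    (forall v : V, exists (s : seq I) (c : I -> R),
       v = \sum_(i <- s) c i *: e i) /\
    (forall (s : seq I) (c : I -> R), uniq s ->
       \sum_(i <- s) c i *: e i = 0 -> forall i, i \in s -> c i = 0).

Lemma free_module_pair (R : comNzRingType) (U V : lmodType R) :
  free_module U -> free_module V -> free_module (U * V)%type.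
Proof.
case=> I [e [eS eF]] [J [f [fS fF]]].
pose g (k : I + J) : (U * V)%type :=
  match k with inl i => (e i, 0) | inr j => (0, f j) end.
have fstE (s : seq (I + J)) (c : I + J -> R) :
    (\sum_(k <- s) c k *: g k).1
    = \sum_(i <- pmap (fun k => if k is inl i then Some i else None) s)
        c (inl i) *: e i.
  elim: s => [|[i|j] s IH] /=; rewrite ?big_nil // !big_cons /= IH //.
  by rewrite scaler0 add0r.
have sndE (s : seq (I + J)) (c : I + J -> R) :
    (\sum_(k <- s) c k *: g k).2
    = \sum_(j <- pmap (fun k => if k is inr j then Some j else None) s)
        c (inr j) *: f j.
  elim: s => [|[i|j] s IH] /=; rewrite ?big_nil // !big_cons /= IH //.
  by rewrite scaler0 add0r.
exists (I + J)%type, g; split.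
  case=> u v; have [s [c ->]] := eS u; have [t [d ->]] := fS v.
  exists (map inl s ++ map inr t),
    (fun k => match k with inl i => c i | inr j => d j end).
  rewrite big_cat !big_map /=; apply/pair_eqP/andP; split; apply/eqP => /=.
    rewrite (raddf_sum (@fst U V)) (raddf_sum (@fst U V)) /=.
    by rewrite [X in _ + X]big1 ?addr0 // => j _; rewrite scaler0.
  rewrite (raddf_sum (@snd U V)) (raddf_sum (@snd U V)) /=.
  by rewrite [X in X + _]big1 ?add0r // => j _; rewrite scaler0.
move=> s c us s0 [i|j] ks.
- apply: (eF _ (fun i => c (inl i)) _ (etrans (esym (fstE s c)) _)).
  + by apply: (@pmap_uniq _ _ _ inl) us => -[].
  + by rewrite s0.
  + by rewrite mem_pmap; apply/mapP; exists (inl i).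
- apply: (fF _ (fun j => c (inr j)) _ (etrans (esym (sndE s c)) _)).
  + by apply: (@pmap_uniq _ _ _ inr) us => -[].
  + by rewrite s0.
  + by rewrite mem_pmap; apply/mapP; exists (inr j).
Qed.

Lemma free_module_ffun (R : comNzRingType) (T : finType) :
  free_module {ffun T -> R^o}.
Proof.
exists T, (fun t => [ffun u => (u == t)%:R]); split.
  move=> v; exists (enum T), v; apply/ffunP => u.
  rewrite sum_ffunE (bigD1_seq u) ?mem_enum ?enum_uniq //= !ffunE eqxx.
  rewrite [X in _ + X]big1 ?addr0; first by rewrite /GRing.scale /= mulr1.
  by move=> t /negPf tu; rewrite !ffunE eq_sym tu scaler0.
move=> s c us /ffunP s0 t ts; have := s0 t.
rewrite sum_ffunE (bigD1_seq t) //= !ffunE eqxx [X in _ + X]big1 ?addr0.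
  by rewrite /GRing.scale /= mulr1.
by move=> u /negPf ut; rewrite !ffunE eq_sym ut scaler0.
Qed.

(* The odd endomorphism d of X = X^0 (+) X^1 is given by its two components
   phi : X^1 -> X^0 and psi : X^0 -> X^1. *)
Record MF (R : comNzRingType) (w : R) := MkMF {
  mf0 : lmodType R;
  mf1 : lmodType R;
  mf0_free : free_module mf0;
  mf1_free : free_module mf1;
  phi : {linear mf1 -> mf0};
  psi : {linear mf0 -> mf1};
  phi_psi : forall x : mf0, phi (psi x) = w *: x;
  psi_phi : forall x : mf1, psi (phi x) = w *: x
}.

(* Closed even elements of the morphism complex MF(X, Y). *)
Record mf_hom (R : comNzRingType) (w : R) (X Y : MF w) := MkHom {
  hom0 : {linear mf0 X -> mf0 Y};
  hom1 : {linear mf1 X -> mf1 Y};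
  hom_phi : forall x : mf1 X, phi Y (hom1 x) = hom0 (phi X x);
  hom_psi : forall x : mf0 X, psi Y (hom0 x) = hom1 (psi X x)
}.

(* f - g = d(h) = d_Y h + h d_X for an odd h = (h0, h1); the morphisms X -> Y in
   [MF^oo(R, w)] are the elements of [mf_hom X Y] modulo this relation. *)
Definition homotopic (R : comNzRingType) (w : R) (X Y : MF w)
    (f g : mf_hom X Y) : Prop :=
  exists (h0 : {linear mf0 X -> mf1 Y}) (h1 : {linear mf1 X -> mf0 Y}),
    (forall x, hom0 f x - hom0 g x = phi Y (h0 x) + h1 (psi X x)) /\
    (forall x, hom1 f x - hom1 g x = psi Y (h1 x) + h0 (phi X x)).

Section HomOperations.
Variables (R : comNzRingType) (w : R).

Definition hom_id (X : MF w) : mf_hom X X :=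
  @MkHom R w X X idfun idfun (fun=> erefl) (fun=> erefl).

Section Comp.
Variables (X Y Z : MF w) (g : mf_hom Y Z) (f : mf_hom X Y).

Fact hom_comp_phi x :
  phi Z ((hom1 g \o hom1 f) x) = (hom0 g \o hom0 f) (phi X x).
Proof. by rewrite /= hom_phi hom_phi. Qed.

Fact hom_comp_psi x :
  psi Z ((hom0 g \o hom0 f) x) = (hom1 g \o hom1 f) (psi X x).
Proof. by rewrite /= hom_psi hom_psi. Qed.

Definition hom_comp : mf_hom X Z :=
  @MkHom R w X Z (hom0 g \o hom0 f) (hom1 g \o hom1 f)
    hom_comp_phi hom_comp_psi.
End Comp.

Section Add.
Variables (X Y : MF w).

Fact hom_zero_phi x :
  phi Y ((\0 : mf1 X -> mf1 Y) x) = (\0 : mf0 X -> mf0 Y) (phi X x).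
Proof. by rewrite /= linear0. Qed.

Fact hom_zero_psi x :
  psi Y ((\0 : mf0 X -> mf0 Y) x) = (\0 : mf1 X -> mf1 Y) (psi X x).
Proof. by rewrite /= linear0. Qed.

Definition hom_zero : mf_hom X Y :=
  @MkHom R w X Y \0 \0 hom_zero_phi hom_zero_psi.

Variables (f g : mf_hom X Y).

Fact hom_add_phi x :
  phi Y ((hom1 f \+ hom1 g) x) = (hom0 f \+ hom0 g) (phi X x).
Proof. by rewrite /= linearD /= !hom_phi. Qed.

Fact hom_add_psi x :
  psi Y ((hom0 f \+ hom0 g) x) = (hom1 f \+ hom1 g) (psi X x).
Proof. by rewrite /= linearD /= !hom_psi. Qed.

Definition hom_add : mf_hom X Y :=
  @MkHom R w X Y (hom0 f \+ hom0 g) (hom1 f \+ hom1 g) hom_add_phi hom_add_psi.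
End Add.
End HomOperations.

Definition mf_iso (R : comNzRingType) (w : R) (X Y : MF w) : Prop :=
  exists (f : mf_hom X Y) (g : mf_hom Y X),
    homotopic (hom_comp g f) (hom_id X) /\
    homotopic (hom_comp f g) (hom_id Y).

Section Shift.
Variables (R : comNzRingType) (w : R) (X : MF w).

Fact shift_phi_psi x : (\- psi X) ((\- phi X) x) = w *: x.
Proof. by rewrite /= (linearN (psi X)) opprK; exact: psi_phi. Qed.

Fact shift_psi_phi x : (\- phi X) ((\- psi X) x) = w *: x.
Proof. by rewrite /= (linearN (phi X)) opprK; exact: phi_psi. Qed.

Definition mf_shift : MF w :=
  @MkMF R w (mf1 X) (mf0 X) (mf1_free X) (mf0_free X) (\- psi X) (\- phi X)
    shift_phi_psi shift_psi_phi.
End Shift.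

(* cone(f) = Y (+) X[1], with d(y, x) = (d_Y y + f x, - d_X x); the standard
   triangles are X -> Y -> cone(f) -> X[1]. *)
Section Cone.
Variables (R : comNzRingType) (w : R) (X Y : MF w) (f : mf_hom X Y).

Definition cone_phi (p : mf1 Y * mf0 X) : mf0 Y * mf1 X :=
  (phi Y p.1 + hom0 f p.2, - psi X p.2).

Definition cone_psi (p : mf0 Y * mf1 X) : mf1 Y * mf0 X :=
  (psi Y p.1 + hom1 f p.2, - phi X p.2).

Fact cone_phi_linear : linear cone_phi.
Proof.
move=> a [y x] [y' x']; rewrite /cone_phi /=.
congr (_, _) => /=; first by rewrite !linearP /= scalerDr addrACA.
by rewrite (linearP (psi X)) opprD scalerN.
Qed.

Fact cone_psi_linear : linear cone_psi.
Proof.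
move=> a [y x] [y' x']; rewrite /cone_psi /=.
congr (_, _) => /=; first by rewrite !linearP /= scalerDr addrACA.
by rewrite (linearP (phi X)) opprD scalerN.
Qed.

HB.instance Definition _ :=
  GRing.isLinear.Build R _ _ _ cone_phi cone_phi_linear.
HB.instance Definition _ :=
  GRing.isLinear.Build R _ _ _ cone_psi cone_psi_linear.

Fact cone_phi_psi p : cone_phi (cone_psi p) = w *: p.
Proof.
case: p => y x; rewrite /cone_phi /cone_psi /=; congr (_, _) => /=.
  by rewrite linearD /= phi_psi hom_phi linearN addrK.
by rewrite linearN opprK psi_phi.
Qed.

Fact cone_psi_phi p : cone_psi (cone_phi p) = w *: p.
Proof.
case: p => y x; rewrite /cone_phi /cone_psi /=; congr (_, _) => /=.
  by rewrite linearD /= psi_phi hom_psi linearN addrK.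
by rewrite linearN opprK phi_psi.
Qed.

Definition mf_cone : MF w :=
  @MkMF R w (mf0 Y * mf1 X)%type (mf1 Y * mf0 X)%type
    (free_module_pair (mf0_free Y) (mf1_free X))
    (free_module_pair (mf1_free Y) (mf0_free X))
    cone_phi cone_psi cone_phi_psi cone_psi_phi.
End Cone.

(* (C, inc) is a coproduct of the family Y in the homotopy category. *)
Definition is_coproduct (R : comNzRingType) (w : R) (I : choiceType)
    (Y : I -> MF w) (C : MF w) (inc : forall i, mf_hom (Y i) C) : Prop :=
  forall (Z : MF w) (f : forall i, mf_hom (Y i) Z),
    exists g : mf_hom C Z,
      (forall i, homotopic (hom_comp g (inc i)) (f i)) /\
      forall g' : mf_hom C Z,
        (forall i, homotopic (hom_comp g' (inc i)) (f i)) -> homotopic g' g.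

(* The canonical map from the direct sum of the [X, Y_i] to [X, C] is
   surjective and injective for every coproduct C of the Y_i. *)
Definition compact (R : comNzRingType) (w : R) (X : MF w) : Prop :=
  forall (I : choiceType) (Y : I -> MF w) (C : MF w)
    (inc : forall i, mf_hom (Y i) C), is_coproduct inc ->
    (forall f : mf_hom X C,
       exists (s : seq I) (g : forall i, mf_hom X (Y i)),
         uniq s /\
         homotopic f
           (\big[@hom_add R w X C/hom_zero X C]_(i <- s)
              hom_comp (inc i) (g i))) /\
    (forall (s : seq I) (g : forall i, mf_hom X (Y i)), uniq s ->
       homotopic
         (\big[@hom_add R w X C/hom_zero X C]_(i <- s) hom_comp (inc i) (g i))
         (hom_zero X C) ->
       forall i, i \in s -> homotopic (g i) (hom_zero X (Y i))).

(* Full triangulated subcategories closed under isomorphisms and coproducts;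
   the zero object is the empty coproduct, and X[-1] = X[1]. *)
Definition localizing (R : comNzRingType) (w : R) (P : MF w -> Prop) : Prop :=
  [/\ forall X Y : MF w, mf_iso X Y -> P X -> P Y,
      forall X : MF w, P X -> P (mf_shift X),
      forall (X Y : MF w) (f : mf_hom X Y), P X -> P Y -> P (mf_cone f)
    & forall (I : choiceType) (Y : I -> MF w) (C : MF w)
        (inc : forall i, mf_hom (Y i) C),
        is_coproduct inc -> (forall i, P (Y i)) -> P C].

Definition generator (R : comNzRingType) (w : R) (X : MF w) : Prop :=
  forall P : MF w -> Prop, localizing P -> P X -> forall Y : MF w, P Y.

Definition compact_generator (R : comNzRingType) (w : R) (X : MF w) : Prop :=
  compact X /\ generator X.

Section Koszul.
Variables (R : comNzRingType) (n : nat) (x ww : 'I_n -> R).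

(* The exterior algebra of R^n in its basis
   e_A = e_(i_1) /\ ... /\ e_(i_p), A = {i_1 < ... < i_p}: an element is the
   function f of its coordinates on the e_A. *)

Definition ksign (i : 'I_n) (A : {set 'I_n}) : R :=
  (-1) ^+ #|[set j in A | (j < i)%N]|.

(* e_(A U i) contributes (-1)^#{j in A | j < i} x_i e_A to its contraction. *)
Definition contraction (f : {set 'I_n} -> R) (A : {set 'I_n}) : R :=
  \sum_(i | i \notin A) ksign i A * x i * f (i |: A).

(* e_i /\ e_(A \ i) = (-1)^#{j in A | j < i} e_A for i in A. *)
Definition ext_mul (f : {set 'I_n} -> R) (A : {set 'I_n}) : R :=
  \sum_(i in A) ksign i A * ww i * f (A :\ i).

Definition koszul_full (f : {set 'I_n} -> R) (A : {set 'I_n}) : R :=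
  contraction f A + ext_mul f A.

(* The part of the exterior algebra of degree congruent to b modulo 2. *)
Definition ext_part (b : bool) : lmodType R :=
  {ffun {A : {set 'I_n} | odd #|A| == b} -> R^o}.

Definition ext_coord (b : bool) (f : ext_part b) (A : {set 'I_n}) : R :=
  if insub A is Some a then f a else 0.

Definition koszul_d (b : bool) (f : ext_part b) : ext_part (~~ b) :=
  [ffun A => koszul_full (ext_coord f) (val A)].

Let toggle (i : 'I_n) (A : {set 'I_n}) := if i \in A then A :\ i else i |: A.
Let kcoef (i : 'I_n) (A : {set 'I_n}) := if i \in A then ww i else x i.

Let koszul_fullE f A :
  koszul_full f A = \sum_i ksign i A * kcoef i A * f (toggle i A).
Proof.
rewrite /koszul_full /contraction /ext_mul addrC.
rewrite [RHS](bigID (fun i => i \in A)) /=; congr (_ + _).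
  by apply: eq_bigr => i iA; rewrite /kcoef /toggle iA.
by apply: eq_bigr => i iA; rewrite /kcoef /toggle (negPf iA).
Qed.

Let in_toggle i j A : (j \in toggle i A) = (j == i) (+) (j \in A).
Proof.
rewrite /toggle; case: ifP => iA; rewrite !inE; case: eqVneq => //= ->;
by rewrite iA.
Qed.

Let toggleC i j A : toggle i (toggle j A) = toggle j (toggle i A).
Proof. by apply/setP => l; rewrite !in_toggle addbCA. Qed.

Let toggleK i A : toggle i (toggle i A) = A.
Proof. by apply/setP => l; rewrite !in_toggle addbA addbb. Qed.

Let odd_toggle i A : odd #|toggle i A| = ~~ odd #|A|.
Proof.
rewrite /toggle; case: ifP => iA; last by rewrite cardsU1 iA.
by rewrite [in RHS](cardsD1 i) iA /= negbK.
Qed.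

Let ksignK i A : ksign i A * ksign i A = 1.
Proof. by rewrite /ksign -expr2 sqrr_sign. Qed.

Let ksign_toggle i j A :
  ksign j (toggle i A) = if (i < j)%N then - ksign j A else ksign j A.
Proof.
rewrite /ksign; case: ifP => ij; last first.
  congr (_ ^+ #|pred_of_set _|); apply/setP => l; rewrite !inE in_toggle.
  by case: eqVneq => //= ->; rewrite ij !andbF.
have -> : [set l in toggle i A | (l < j)%N]
    = toggle i [set l in A | (l < j)%N].
  by apply/setP => l; rewrite !inE !in_toggle !inE;
     case: eqVneq => //= ->; rewrite ij !andbT.
by rewrite -signr_odd odd_toggle signrN signr_odd.
Qed.

Let kcoef_toggle i j A : j != i -> kcoef j (toggle i A) = kcoef j A.
Proof. by move=> /negPf ji; rewrite /kcoef in_toggle ji. Qed.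

Let kcoefK i A : kcoef i A * kcoef i (toggle i A) = x i * ww i.
Proof. by rewrite /kcoef in_toggle eqxx /=; case: ifP => //= _; rewrite mulrC. Qed.

Let koszul_fullK f A :
  koszul_full (koszul_full f) A = (\sum_i x i * ww i) * f A.
Proof.
pose F i j := ksign i A * kcoef i A *
  (ksign j (toggle i A) * kcoef j (toggle i A) * f (toggle j (toggle i A))).
have -> : koszul_full (koszul_full f) A = \sum_i \sum_j F i j.
  by rewrite koszul_fullE; apply: eq_bigr => i _;
     rewrite koszul_fullE mulr_sumr.
have Fdiag i : F i i = x i * ww i * f A.
  rewrite /F ksign_toggle ltnn toggleK mulrA (mulrACA (ksign i A)) ksignK.
  by rewrite mul1r kcoefK.
have Fanti (i j : 'I_n) : (i < j)%N -> F i j = - F j i.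
  move=> ij; have ji : j != i by rewrite -val_eqE gtn_eqF.
  rewrite /F !ksign_toggle ij ltnNge (ltnW ij) /= !kcoef_toggle // 1?eq_sym //.
  by rewrite toggleC !mulNr mulrN mulrCA.
transitivity (\sum_i (F i i + \sum_(j | j != i) F i j)).
  by apply: eq_bigr => i _; rewrite (bigD1 i).
rewrite big_split /= [X in _ + X](_ : _ = 0) ?addr0.
  by rewrite mulr_suml; apply: eq_bigr => i _.
rewrite (eq_bigr (fun i : 'I_n => \sum_(j : 'I_n | (j < i)%N) F i j
                        + \sum_(j : 'I_n | (i < j)%N) F i j)); last first.
  move=> i _; rewrite (bigID (fun j : 'I_n => (j < i)%N)) /=.
  congr (_ + _); apply: eq_bigl => j; rewrite -val_eqE /=; first by case: ltngtP.
  by case: ltngtP.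
rewrite big_split /= [X in X + _](exchange_big_dep predT) //= -big_split /=.
apply: big1 => i _; rewrite -big_split /=; apply: big1 => j ij.
by rewrite (Fanti i j) ?addrN.
Qed.

Fact koszul_d_linear b : linear (@koszul_d b).
Proof.
move=> a f g; apply/ffunP => A; rewrite !ffunE !koszul_fullE.
rewrite scaler_sumr -big_split; apply: eq_bigr => i _ /=.
rewrite /ext_coord; case: insub => [B|]; last by rewrite !mulr0 scaler0 addr0.
by rewrite !ffunE mulrDr /GRing.scale /= mulrCA.
Qed.

HB.instance Definition _ b :=
  GRing.isLinear.Build R _ _ _ (@koszul_d b) (@koszul_d_linear b).

Let ext_coord_koszul_d b (f : ext_part b) A :
  ext_coord (koszul_d f) A = koszul_full (ext_coord f) A.
Proof.
rewrite {1}/ext_coord; case: insubP => [B _ <-|]; first by rewrite ffunE.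
move=> Ab; rewrite koszul_fullE big1 // => i _.
rewrite /ext_coord insubN ?mulr0 // odd_toggle.
by apply: contra Ab => /eqP <-; rewrite negbK.
Qed.

Variable w : R.
Hypothesis w_def : w = \sum_i x i * ww i.

Fact koszul_phi_psi (f : ext_part false) :
  (@koszul_d true (@koszul_d false f) : ext_part false) = w *: f.
Proof.
apply/ffunP => A; rewrite !ffunE.
rewrite -[LHS]/(koszul_full (ext_coord (koszul_d f)) (val A)).
have -> : koszul_full (ext_coord (koszul_d f)) (val A)
    = koszul_full (koszul_full (ext_coord f)) (val A).
  by rewrite !koszul_fullE; apply: eq_bigr => i _; rewrite ext_coord_koszul_d.
by rewrite koszul_fullK -w_def /ext_coord valK.
Qed.

Fact koszul_psi_phi (f : ext_part true) :
  (@koszul_d false (@koszul_d true f) : ext_part true) = w *: f.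
Proof.
apply/ffunP => A; rewrite !ffunE.
rewrite -[LHS]/(koszul_full (ext_coord (koszul_d f)) (val A)).
have -> : koszul_full (ext_coord (koszul_d f)) (val A)
    = koszul_full (koszul_full (ext_coord f)) (val A).
  by rewrite !koszul_fullE; apply: eq_bigr => i _; rewrite ext_coord_koszul_d.
by rewrite koszul_fullK -w_def /ext_coord valK.
Qed.

(* The stabilization k^stab of the residue field when x is a regular sequence
   generating the maximal ideal. *)
Definition koszul_mf : MF w :=
  @MkMF R w (ext_part false) (ext_part true)
    (free_module_ffun _ _) (free_module_ffun _ _)
    (@koszul_d true) (@koszul_d false) koszul_phi_psi koszul_psi_phi.
End Koszul.

(* Main.v *)
(* The factorization K = k^stab is compact because its modules have finite
   rank: a coproduct in the homotopy category is the module-theoretic direct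
   sum, and a map from K into it meets finitely many summands.

   For generation, let P be a localizing subcategory containing K, let x be
   the regular sequence and let Kos(X) be the iterated cone of the
   multiplications by x_1, ..., x_n on X. Since x is regular, Kos(X) resolves
   X / mX: for F free, Hom(F, Kos(X)) -> Hom(F, X / mX) is a surjective
   quasi-isomorphism. Hence a homotopy retraction modulo m of X onto Y lifts
   to a homotopy retraction of Kos(X) onto Kos(Y). Modulo m the factorization X
   is a complex of k-vector spaces, which retracts onto its homology, and this
   is a retract of the reduction of a direct sum Y of copies of K and K[1], one
   for each basis vector of X. So Kos(X) is a retract of Kos(Y), which is in P.

   Conversely each D_i w and w itself are null-homotopic on every X: for a
   connection nabla on X, [[nabla, d], d] = D w. As R / (w, D_i w) has finite
   dimension, a power of each x_i acts by 0 in the homotopy category, so X is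
   a retract of the cone of x_i^N, which is built from the cone of x_i by the
   octahedral axiom. Therefore X is in P as soon as Kos(X) is. *)

From HB Require Import structures.
From mathcomp Require Import all_boot all_order all_algebra.
From mathcomp Require Import boolp.
From mathcomp Require classical_sets.
Require Import Defs.

Set Implicit Arguments.
Unset Strict Implicit.
Unset Printing Implicit Defensive.

Import GRing.Theory.
Local Open Scope ring_scope.

(** * Reflection for identities in abelian groups *)

Inductive zexp :=
  ZVar of nat | ZAdd of zexp & zexp | ZOpp of zexp | ZZero.

Section ZmodReflection.
Variable M : zmodType.

Fixpoint zeval (env : seq M) (e : zexp) : M :=
  match e with
  | ZVar i => nth 0 env i
  | ZAdd a b => zeval env a + zeval env b
  | ZOpp a => - zeval env a
  | ZZero => 0
  end.

Fixpoint zcoef (i : nat) (e : zexp) : int :=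
  match e with
  | ZVar j => (j == i)%:R
  | ZAdd a b => zcoef i a + zcoef i b
  | ZOpp a => - zcoef i a
  | ZZero => 0
  end.

Lemma zevalE env e :
  zeval env e = \sum_(i < size env) nth 0 env i *~ zcoef i e.
Proof.
elim: e => [j|a IHa b IHb|a IHa|] /=.
- case: (ltnP j (size env)) => [lt_j|le_j].
    rewrite (bigD1 (Ordinal lt_j)) //= eqxx big1 ?addr0 // => i.
    by rewrite -val_eqE /= eq_sym => /negPf ->; rewrite mulr0z.
  rewrite nth_default // big1 // => i _.
  by rewrite gtn_eqF ?mulr0z // (leq_trans (ltn_ord i)).
- by rewrite IHa IHb -big_split; apply: eq_bigr => i _; rewrite mulrzDr.
- by rewrite IHa -sumrN; apply: eq_bigr => i _; rewrite mulrNz.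
- by rewrite big1 // => i _; rewrite mulr0z.
Qed.

Lemma zeval_eq env e1 e2 :
  all (fun i => zcoef i e1 == zcoef i e2) (iota 0 (size env)) ->
  zeval env e1 = zeval env e2.
Proof.
move=> /allP eq12; rewrite !zevalE; apply: eq_bigr => i _.
by rewrite (eqP (eq12 i _)) // mem_iota ltn_ord.
Qed.

End ZmodReflection.

(** Atoms are compared by [unify], hence up to conversion. The inner [match] lets this test run
    while a term is being built, and its failure leads to the next branch. *)
Ltac z_find x env :=
  lazymatch env with
  | ?y :: ?l =>
      match constr:(true) with
      | _ => let _ := match constr:(true) with _ => unify x y end in
             constr:(0%N)
      | _ => let n := z_find x l in constr:(S n)
      end
  end.
Ltac z_mem x env :=
  lazymatch env with
  | nil => constr:(false)
  | ?y :: ?l =>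
      match constr:(true) with
      | _ => let _ := match constr:(true) with _ => unify x y end in
             constr:(true)
      | _ => z_mem x l
      end
  end.
Ltac z_atoms env e :=
  lazymatch e with
  | (?a + ?b)%R => let env := z_atoms env a in z_atoms env b
  | (- ?a)%R => z_atoms env a
  | 0%R => env
  | _ => match z_mem e env with
         | true => env
         | false => constr:(e :: env)
         end
  end.
Ltac z_reify env e :=
  lazymatch e with
  | (?a + ?b)%R =>
      let a := z_reify env a in let b := z_reify env b in constr:(ZAdd a b)
  | (- ?a)%R => let a := z_reify env a in constr:(ZOpp a)
  | 0%R => constr:(ZZero)
  | _ => let n := z_find e env in constr:(ZVar n)
  end.
(** Closes an identity of sums and opposites by comparing the integer coefficients of its atoms.
    Scalings and images under maps count as atoms, so linearity has to be rewritten beforehand. *)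
Ltac zmod :=
  lazymatch goal with
  | |- @eq ?T ?a ?b =>
      let env := z_atoms (@nil T) a in
      let env := z_atoms env b in
      let ea := z_reify env a in
      let eb := z_reify env b in
      refine (@zeval_eq _ env ea eb _); vm_compute; reflexivity
  end.

(** * Linear maps on free modules *)

Section LinearMaps.
Variable R : comNzRingType.

Lemma linear_exists (U V : lmodType R) (f : U -> V) :
  linear f -> exists L : {linear U -> V}, L =1 f.
Proof.
move=> fL; pose m := GRing.isLinear.Build R U V *:%R f fL.
by exists (HB.pack_for {linear U -> V} f m).
Qed.

Definition basis (V : lmodType R) (I : choiceType) (e : I -> V) : Prop :=
  (forall v : V, exists (s : seq I) (c : I -> R),
     v = \sum_(i <- s) c i *: e i) /\
  (forall (s : seq I) (c : I -> R), uniq s ->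
     \sum_(i <- s) c i *: e i = 0 -> forall i, i \in s -> c i = 0).

Lemma sum_extend (I : choiceType) (W : lmodType R) (u : I -> W)
    (s r : seq I) (c : I -> R) :
  uniq s -> uniq r -> {subset s <= r} ->
  \sum_(i <- s) c i *: u i
  = \sum_(i <- r) (if i \in s then c i else 0) *: u i.
Proof.
move=> us ur sr; rewrite [RHS](bigID (fun i => i \in s)) /=.
rewrite [X in _ = _ + X]big1 ?addr0; last first.
  by move=> i /negPf ->; rewrite scale0r.
rewrite [RHS](eq_bigr (fun i => c i *: u i)); last by move=> i ->.
rewrite -[RHS]big_filter; apply/perm_big/uniq_perm; rewrite ?filter_uniq //.
by move=> i; rewrite mem_filter; case: (boolP (i \in s)) => // /sr.
Qed.

(** Spanning provides lists with possible repetitions, whereas independence speaks of duplicate-free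
    ones; coefficients of repeated indices are added. *)
Lemma basis_uniq_span (V : lmodType R) (I : choiceType) (e : I -> V) :
  basis e -> forall v : V, exists (s : seq I) (c : I -> R),
    uniq s /\ v = \sum_(i <- s) c i *: e i.
Proof.
case=> eS _ v; have [s [c ->]] := eS v; elim: s => [|i s [t [d [ut dE]]]].
  by exists [::], c.
have [r rE ur] : exists2 r, r =i i :: t & uniq r.
  by exists (undup (i :: t)); [exact: mem_undup | exact: undup_uniq].
exists r, (fun j => (if j \in [:: i] then c j else 0)
                    + (if j \in t then d j else 0)); split=> //.
under [RHS]eq_bigr do rewrite scalerDl.
rewrite big_cons dE big_split /= -!sum_extend ?big_seq1 // => j.
  by rewrite rE !inE => ->; rewrite orbT.
by rewrite rE !inE => ->.
Qed.

(** Both combinations are extended by zeros to a common list, where independence makes the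
    coefficients agree; so the linear extension of [u] is well defined. *)
Lemma basis_lift_wd (V W : lmodType R) (I : choiceType) (e : I -> V)
    (u : I -> W) (s t : seq I) (c d : I -> R) :
  basis e -> uniq s -> uniq t ->
  \sum_(i <- s) c i *: e i = \sum_(i <- t) d i *: e i ->
  \sum_(i <- s) c i *: u i = \sum_(i <- t) d i *: u i.
Proof.
move=> [_ eF] us ut; have ur := undup_uniq (s ++ t).
have sr : {subset s <= undup (s ++ t)}.
  by move=> i; rewrite mem_undup mem_cat => ->.
have tr : {subset t <= undup (s ++ t)}.
  by move=> i; rewrite mem_undup mem_cat => ->; rewrite orbT.
rewrite !(sum_extend _ _ us ur sr) !(sum_extend _ _ ut ur tr).
move=> /eqP; rewrite -subr_eq0 -sumrB => /eqP.
under eq_bigr do rewrite -scalerBl.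
move=> /(eF _ _ ur) cd; apply: eq_big_seq => i /cd /eqP.
by rewrite subr_eq0 => /eqP ->.
Qed.

Lemma basis_lift (V W : lmodType R) (I : choiceType) (e : I -> V)
    (u : I -> W) :
  basis e -> exists L : {linear V -> W}, forall i, L (e i) = u i.
Proof.
move=> eB.
have /choice[s rep] : forall v, exists s, exists c : I -> R,
    uniq s /\ v = \sum_(i <- s) c i *: e i by exact: basis_uniq_span.
have {rep} /choice[c rep] := rep.
pose f v := \sum_(i <- s v) c v i *: u i.
have fE v t d : uniq t -> v = \sum_(i <- t) d i *: e i ->
    f v = \sum_(i <- t) d i *: u i.
  move=> ut vE; apply: (basis_lift_wd _ eB) => //; first by case: (rep v).
  by rewrite -vE; case: (rep v).
have [|L LE] := @linear_exists V W f.
  move=> a v w; pose r := undup (s v ++ s w).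
  have ur : uniq r by exact: undup_uniq.
  have sr : {subset s v <= r} by move=> i; rewrite mem_undup mem_cat => ->.
  have tr : {subset s w <= r}.
    by move=> i; rewrite mem_undup mem_cat => ->; rewrite orbT.
  have [us vE] := rep v; have [ut wE] := rep w.
  rewrite (fE _ r (fun i => a * (if i \in s v then c v i else 0)
                            + (if i \in s w then c w i else 0))) //.
    rewrite /f !(sum_extend _ _ _ ur sr) // !(sum_extend _ _ _ ur tr) //.
    rewrite scaler_sumr -big_split; apply: eq_bigr => i _ /=.
    by rewrite scalerDl scalerA.
  rewrite {1}vE {1}wE !(sum_extend _ _ _ ur sr) // !(sum_extend _ _ _ ur tr) //.
  rewrite scaler_sumr -big_split; apply: eq_bigr => i _ /=.
  by rewrite scalerDl scalerA.
exists L => i; rewrite LE (fE _ [:: i] (fun=> 1)) ?big_seq1 ?scale1r //.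
Qed.

Lemma basis_ext (V W : lmodType R) (I : choiceType) (e : I -> V)
    (L L' : {linear V -> W}) :
  basis e -> (forall i, L (e i) = L' (e i)) -> L =1 L'.
Proof.
move=> [eS _] LE v; have [s [c ->]] := eS v; rewrite !linear_sum.
by apply: eq_bigr => i _; rewrite !linearZ /= LE.
Qed.

Definition linear_rel (V W : lmodType R) (Q : V -> W -> Prop) : Prop :=
  Q 0 0 /\ forall (a : R) v w v' w', Q v w -> Q v' w' ->
    Q (a *: v + v') (a *: w + w').

(** Projectivity of free modules in relational form: values are chosen on a basis and extended
    linearly. It replaces liftings along quotient maps. *)
Lemma free_section (V W : lmodType R) (Q : V -> W -> Prop) :
  free_module V -> linear_rel Q -> (forall v, exists w, Q v w) ->
  exists L : {linear V -> W}, forall v, Q v (L v).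
Proof.
move=> [I [e eB]] [Q0 QL] /choice[u Qu].
have [L LE] := basis_lift (u \o e) eB.
exists L => v; have [s [c ->]] := eB.1 v.
rewrite linear_sum; elim: s => [|i s IHs]; first by rewrite !big_nil.
by rewrite !big_cons linearZ /= LE; apply: QL.
Qed.

(** The coordinate functionals extend Kronecker deltas linearly. The expansion is stated for every
    list containing a support, so that several vectors can share one list. *)
Lemma basis_coord (V : lmodType R) (I : choiceType) (e : I -> V) :
  basis e -> exists c : I -> {linear V -> R^o},
    (forall i j, c i (e j) = (i == j)%:R) /\
    forall v, exists s : seq I, uniq s /\
      (forall t : seq I, uniq t -> {subset s <= t} ->
         v = \sum_(i <- t) c i v *: e i).
Proof.
move=> eB.
have /choice[c cE] i := basis_lift (fun j => (i == j)%:R : R^o) eB.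
exists c; split=> [//|v]; have [s [d [us vE]]] := basis_uniq_span eB v.
exists s; split=> // t ut st; rewrite {1}vE (sum_extend _ _ us ut st).
apply: eq_big_seq => i it; congr (_ *: _); rewrite vE linear_sum /=.
under eq_bigr do rewrite linearZ /= cE.
case: ifP => [si|/negP nsi].
  rewrite (bigD1_seq i) //= eqxx big1 => [|j /negPf ij].
    by rewrite addr0 /GRing.scale /= mulr1.
  by rewrite eq_sym ij scaler0.
rewrite big1_seq // => j /andP[_ js]; case: eqP => [ij|]; last first.
  by rewrite scaler0.
by case: nsi; rewrite ij.
Qed.

End LinearMaps.

(** * Direct sums of modules *)

Section DirectSum.
Variables (R : comNzRingType) (I : choiceType) (V : I -> lmodType R).

Definition has_finite_support (f : forall i, V i) : Prop :=
  exists s : seq I, forall i, i \notin s -> f i = 0.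

(** The support merely exists, so by proof irrelevance elements are equal as soon as they agree
    pointwise. *)
Record dsum := DSum {
  dsum_fun :> forall i, V i;
  dsum_support : has_finite_support dsum_fun
}.

HB.instance Definition _ := gen_eqMixin dsum.
HB.instance Definition _ := gen_choiceMixin dsum.

Lemma dsum_eq (f g : dsum) : (forall i, f i = g i) -> f = g.
Proof.
case: f g => [f fS] [g gS] /= fg0; have fg := functional_extensionality_dep fg0.
by case: g / fg gS fg0 => gS _; rewrite (Prop_irrelevance fS gS).
Qed.

Fact dsum_zero_subproof : has_finite_support (fun i => 0 : V i).
Proof. by exists [::]. Qed.

Fact dsum_add_subproof (f g : dsum) : has_finite_support (fun i => f i + g i).
Proof.
case: f g => [f [s fs]] [g [t gt]]; exists (s ++ t) => i /=.
by rewrite mem_cat negb_or => /andP[/fs -> /gt ->]; rewrite addr0.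
Qed.

Fact dsum_opp_subproof (f : dsum) : has_finite_support (fun i => - f i).
Proof. by case: f => f [s fs]; exists s => i /fs /= ->; rewrite oppr0. Qed.

Fact dsum_scale_subproof (a : R) (f : dsum) :
  has_finite_support (fun i => a *: f i).
Proof. by case: f => f [s fs]; exists s => i /fs /= ->; rewrite scaler0. Qed.

Definition dsum_zero := DSum dsum_zero_subproof.
Definition dsum_add f g := DSum (dsum_add_subproof f g).
Definition dsum_opp f := DSum (dsum_opp_subproof f).
Definition dsum_scale a f := DSum (dsum_scale_subproof a f).

Fact dsum_addA : associative dsum_add.
Proof. by move=> f g h; apply: dsum_eq => i /=; rewrite addrA. Qed.
Fact dsum_addC : commutative dsum_add.
Proof. by move=> f g; apply: dsum_eq => i /=; rewrite addrC. Qed.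
Fact dsum_add0 : left_id dsum_zero dsum_add.
Proof. by move=> f; apply: dsum_eq => i /=; rewrite add0r. Qed.
Fact dsum_addN : left_inverse dsum_zero dsum_opp dsum_add.
Proof. by move=> f; apply: dsum_eq => i /=; rewrite addNr. Qed.

HB.instance Definition _ :=
  GRing.isZmodule.Build dsum dsum_addA dsum_addC dsum_add0 dsum_addN.

Fact dsum_scaleA a b f :
  dsum_scale a (dsum_scale b f) = dsum_scale (a * b) f.
Proof. by apply: dsum_eq => i /=; rewrite scalerA. Qed.
Fact dsum_scale1 : left_id 1 dsum_scale.
Proof. by move=> f; apply: dsum_eq => i /=; rewrite scale1r. Qed.
Fact dsum_scaleDr : right_distributive dsum_scale +%R.
Proof. by move=> a f g; apply: dsum_eq => i /=; rewrite scalerDr. Qed.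
Fact dsum_scaleDl f : {morph dsum_scale^~ f : a b / a + b}.
Proof. by move=> a b; apply: dsum_eq => i /=; rewrite scalerDl. Qed.

HB.instance Definition _ := GRing.Zmodule_isLmodule.Build R dsum
  dsum_scaleA dsum_scale1 dsum_scaleDr dsum_scaleDl.

Definition dsum_pr (i : I) (f : dsum) : V i := f i.
Fact dsum_pr_linear i : linear (dsum_pr i).
Proof. by []. Qed.
HB.instance Definition _ i :=
  GRing.isLinear.Build R _ _ _ (dsum_pr i) (dsum_pr_linear i).

Fact dsum_inj_subproof i (v : V i) :
  has_finite_support (dfwith (fun j => 0 : V j) v).
Proof.
exists [:: i] => j; rewrite inE => ji.
by rewrite dfwith_out // eq_sym.
Qed.
Definition dsum_inj i (v : V i) : dsum := DSum (dsum_inj_subproof v).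
Arguments dsum_pr : simpl never.
Arguments dsum_inj : simpl never.

Lemma dsum_inj_in i (v : V i) : dsum_inj v i = v.
Proof. exact: dfwith_in. Qed.
Lemma dsum_inj_out i j (v : V i) : i != j -> dsum_inj v j = 0.
Proof. exact: dfwith_out. Qed.

Lemma dsum_pr_in i (v : V i) : dsum_pr i (dsum_inj v) = v.
Proof. exact: dfwith_in. Qed.
Lemma dsum_pr_out i j (v : V i) : i != j -> dsum_pr j (dsum_inj v) = 0.
Proof. exact: dfwith_out. Qed.

Fact dsum_inj_linear i : linear (@dsum_inj i).
Proof.
move=> a v w; apply: dsum_eq => j; rewrite /dsum_inj /=.
have [<-|ij] := eqVneq i j; first by rewrite !dfwith_in.
by rewrite !dfwith_out // scaler0 addr0.
Qed.
HB.instance Definition _ i :=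
  GRing.isLinear.Build R _ _ _ (@dsum_inj i) (@dsum_inj_linear i).

Lemma dsum_sum (f : dsum) (s : seq I) : uniq s ->
  (forall i, i \notin s -> f i = 0) -> f = \sum_(i <- s) dsum_inj (f i).
Proof.
move=> us fs; apply: dsum_eq => j.
rewrite -[RHS]/(dsum_pr j _) linear_sum /=.
have [js|js] := boolP (j \in s).
  rewrite (bigD1_seq j) //= /dsum_pr dsum_inj_in big1 ?addr0 // => i ij.
  by rewrite dsum_inj_out.
rewrite fs // big1_seq // => i /andP[_ si]; rewrite /dsum_pr dsum_inj_out //.
by apply: contraNneq js => <-.
Qed.

Lemma dsum_uniq_support (f : dsum) :
  exists s : seq I, uniq s /\ forall i, i \notin s -> f i = 0.
Proof.
case: (dsum_support f) => s fs; exists (undup s); split.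
  exact: undup_uniq.
by move=> i; rewrite mem_undup; apply: fs.
Qed.

Lemma dsum_ext (W : lmodType R) (L L' : {linear dsum -> W}) :
  (forall i v, L (@dsum_inj i v) = L' (dsum_inj v)) -> L =1 L'.
Proof.
move=> LE f; have [s [us fs]] := dsum_uniq_support f.
rewrite (dsum_sum us fs) !linear_sum.
by apply: eq_bigr => i _; apply: LE.
Qed.

(** The sum is taken over a chosen support; by [gE] it does not depend on the choice, whence
    linearity. *)
Lemma dsum_lift (W : lmodType R) (g : forall i, {linear V i -> W}) :
  exists L : {linear dsum -> W}, forall i v, L (@dsum_inj i v) = g i v.
Proof.
have /choice[s sP] := dsum_uniq_support.
have gE (t : seq I) (f : dsum) :
    uniq t -> (forall i, i \notin t -> f i = 0) ->
    \sum_(i <- s f) g i (f i) = \sum_(i <- t) g i (f i).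
  move=> ut ft; have [us fs] := sP f.
  rewrite (bigID (fun i => i \in t)) /= [X in _ + X]big1 ?addr0; last first.
    by move=> i /ft ->; rewrite linear0.
  rewrite [RHS](bigID (fun i => i \in s f)) /= [X in _ = _ + X]big1 ?addr0.
    rewrite -[LHS]big_filter -[RHS]big_filter.
    apply/perm_big/uniq_perm; rewrite ?filter_uniq //.
    by move=> i; rewrite !mem_filter andbC.
  by move=> i /fs ->; rewrite linear0.
have [|L LE] := @linear_exists R dsum W (fun f => \sum_(i <- s f) g i (f i)).
  move=> a f h; have [us fs] := sP f; have [ut ht] := sP h.
  have ur := undup_uniq (s f ++ s h).
  rewrite !(gE _ _ ur) => [|i|i|i].
  - by rewrite scaler_sumr -big_split; apply: eq_bigr => i _;
       rewrite /= linearP.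
  - by rewrite mem_undup mem_cat negb_or => /andP[_ /ht].
  - by rewrite mem_undup mem_cat negb_or => /andP[/fs].
  - rewrite mem_undup mem_cat negb_or => /andP[/fs f0 /ht h0] /=.
    by rewrite f0 h0 scaler0 addr0.
exists L => i v; rewrite LE (gE [:: i]) ?big_seq1 ?dsum_inj_in // => j.
by rewrite inE => ji; rewrite dsum_inj_out // eq_sym.
Qed.

(** The basis is the disjoint union of bases of the summands; the i-th projection followed by
    [c i j] reads off a coefficient. *)
Lemma dsum_free : (forall i, free_module (V i)) -> free_module dsum.
Proof.
move=> freeV.
pose J i := projT1 (cid (freeV i)).
have /(_ _)/cid-/all_sig[e eB] i : exists e : J i -> V i, basis e.
  exact: (projT2 (cid (freeV i))).
have /(_ _)/cid-/all_sig[c cP] i := basis_coord (eB i).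
pose E (p : {i : I & J i}) := dsum_inj (e _ (tagged p)).
exists {i : I & J i}, E; split=> [f|s d us s0 [i j] ijs].
  have [s [us fs]] := dsum_uniq_support f.
  have /(_ _)/cid-/all_sig[t tP] i := (cP i).2 (f i).
  exists [seq Tagged J j | i <- s, j <- t i],
    (fun p => c _ (tagged p) (f (tag p))).
  rewrite big_allpairs_dep {1}(dsum_sum us fs); apply: eq_bigr => i _ /=.
  have [ut /(_ (t i) ut (fun=> id)) {1}->] := tP i.
  by rewrite linear_sum; apply: eq_bigr => j _; rewrite linearZ.
have hE p : c i j (dsum_pr i (E p)) = (Tagged J j == p)%:R.
  case: p => i' j'; rewrite /E; have [ii|ii] := eqVneq i' i.
    case: i / ii j {ijs} => j.
    by rewrite dsum_pr_in (cP i').1 -tag_eqE /tag_eq /= eqxx tagged_asE.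
  rewrite dsum_pr_out // linear0; case: eqP => // -[eq_i].
  by rewrite eq_i eqxx in ii.
pose h : {linear dsum -> R^o} := c i j \o dsum_pr i.
have := congr1 h s0; rewrite linear_sum linear0.
rewrite (eq_bigr (fun p => d p * (Tagged J j == p)%:R)) => [|p _]; last first.
  by rewrite linearZ /= hE.
rewrite (bigD1_seq (Tagged J j)) //= eqxx mulr1 big1 ?addr0 // => p.
by rewrite eq_sym => /negPf ->; rewrite mulr0.
Qed.

End DirectSum.

(** * The homotopy category and its localizing subcategories *)

Section Homotopies.
Variables (R : comNzRingType) (w : R).
Implicit Types X Y Z : MF w.

Lemma homotopic_eq X Y (f g : mf_hom X Y) :
  hom0 f =1 hom0 g -> hom1 f =1 hom1 g -> homotopic f g.
Proof.
move=> fg0 fg1; exists \0, \0; split=> x /=.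
  by rewrite fg0 subrr linear0 addr0.
by rewrite fg1 subrr linear0 addr0.
Qed.

Lemma homotopic_refl X Y (f : mf_hom X Y) : homotopic f f.
Proof. exact: homotopic_eq. Qed.

Lemma homotopic_sym X Y (f g : mf_hom X Y) : homotopic f g -> homotopic g f.
Proof.
move=> [h0 [h1 [hE0 hE1]]]; exists (\- h0), (\- h1); split=> x /=.
  by rewrite linearN -opprD -hE0 opprB.
by rewrite linearN -opprD -hE1 opprB.
Qed.

Lemma homotopic_trans X Y (f g k : mf_hom X Y) :
  homotopic f g -> homotopic g k -> homotopic f k.
Proof.
move=> [h0 [h1 [hE0 hE1]]] [l0 [l1 [lE0 lE1]]].
exists (h0 \+ l0), (h1 \+ l1); split=> x /=.
  by rewrite -(subrKA (hom0 g x)) hE0 lE0 linearD /=; zmod.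
by rewrite -(subrKA (hom1 g x)) hE1 lE1 linearD /=; zmod.
Qed.

Lemma homotopic_compl X Y Z (k : mf_hom Y Z) (f g : mf_hom X Y) :
  homotopic f g -> homotopic (hom_comp k f) (hom_comp k g).
Proof.
move=> [h0 [h1 [hE0 hE1]]]; exists (hom1 k \o h0), (hom0 k \o h1).
split=> x /=.
  by rewrite -linearB hE0 linearD /= hom_phi.
by rewrite -linearB hE1 linearD /= hom_psi.
Qed.

Lemma homotopic_compr X Y Z (k : mf_hom X Y) (f g : mf_hom Y Z) :
  homotopic f g -> homotopic (hom_comp f k) (hom_comp g k).
Proof.
move=> [h0 [h1 [hE0 hE1]]]; exists (h0 \o hom0 k), (h1 \o hom1 k).
by split=> x /=; rewrite ?hE0 ?hE1 ?hom_phi ?hom_psi.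
Qed.

Lemma homotopic_add X Y (f g f' g' : mf_hom X Y) :
  homotopic f g -> homotopic f' g' ->
  homotopic (hom_add f f') (hom_add g g').
Proof.
move=> [h0 [h1 [hE0 hE1]]] [l0 [l1 [lE0 lE1]]].
exists (h0 \+ l0), (h1 \+ l1); split=> x /=.
  by rewrite opprD addrACA hE0 lE0 (linearD (phi Y)); zmod.
by rewrite opprD addrACA hE1 lE1 (linearD (psi Y)); zmod.
Qed.

Definition hom_scale_fun (a : R) (V : lmodType R) (v : V) : V := a *: v.
Fact hom_scale_linear a V : linear (@hom_scale_fun a V).
Proof.
by move=> b u v; rewrite /hom_scale_fun scalerDr !scalerA mulrC.
Qed.
HB.instance Definition _ a V :=
  GRing.isLinear.Build R V V *:%R (@hom_scale_fun a V) (@hom_scale_linear a V).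

Fact hom_scale_phi a X x :
  phi X (hom_scale_fun a x) = hom_scale_fun a (phi X x).
Proof. exact: linearZ. Qed.
Fact hom_scale_psi a X x :
  psi X (hom_scale_fun a x) = hom_scale_fun a (psi X x).
Proof. exact: linearZ. Qed.
Definition hom_scale (a : R) X : mf_hom X X :=
  @MkHom R w X X (@hom_scale_fun a (mf0 X)) (@hom_scale_fun a (mf1 X))
    (@hom_scale_phi a X) (@hom_scale_psi a X).

(** These scalars form an ideal, the annihilator of the homotopy category. *)
Definition null_scalar (a : R) : Prop :=
  forall X, homotopic (hom_scale a X) (hom_zero X X).

Lemma null_scalarD a b : null_scalar a -> null_scalar b -> null_scalar (a + b).
Proof.
move=> na nb X; have [h0 [h1 [hE0 hE1]]] := na X.
have [l0 [l1 [lE0 lE1]]] := nb X.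
exists (h0 \+ l0), (h1 \+ l1).
move: hE0 hE1 lE0 lE1; rewrite /= /hom_scale_fun => hE0 hE1 lE0 lE1.
split=> x; rewrite /= scalerDl subr0.
  by rewrite -[a *: x]subr0 -[b *: x]subr0 hE0 lE0 (linearD (phi X)); zmod.
by rewrite -[a *: x]subr0 -[b *: x]subr0 hE1 lE1 (linearD (psi X)); zmod.
Qed.

Lemma null_scalarM a b : null_scalar b -> null_scalar (a * b).
Proof.
move=> nb X.
apply: (homotopic_trans (g := hom_comp (hom_scale a X) (hom_scale b X))).
  by apply: homotopic_eq => x /=; rewrite /hom_scale_fun scalerA.
apply: (homotopic_trans (homotopic_compl _ (nb X))).
by apply: homotopic_eq => x /=; rewrite linear0.
Qed.

Lemma null_scalar0 : null_scalar 0.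
Proof. by move=> X; apply: homotopic_eq => x /=; apply: scale0r. Qed.

Lemma null_scalar_sum (I : Type) (s : seq I) (a b : I -> R) :
  (forall i, null_scalar (b i)) -> null_scalar (\sum_(i <- s) a i * b i).
Proof.
move=> nb; apply: big_ind => [||i _]; first exact: null_scalar0.
  exact: null_scalarD.
exact: null_scalarM.
Qed.

(** One half of the differential serves as a homotopy: h = (psi, 0). *)
Lemma null_scalar_w : null_scalar w.
Proof.
move=> X; exists (psi X), \0; split=> x; rewrite /= /hom_scale_fun subr0.
  by rewrite phi_psi addr0.
by rewrite psi_phi linear0 add0r.
Qed.

Lemma big_hom_add0 X Y (I : Type) (s : seq I) (F : I -> mf_hom X Y) x :
  hom0 (\big[@hom_add R w X Y/hom_zero X Y]_(i <- s) F i) x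
  = \sum_(i <- s) hom0 (F i) x.
Proof. by elim: s => [|i s IHs]; rewrite ?big_nil // !big_cons /= IHs. Qed.

Lemma big_hom_add1 X Y (I : Type) (s : seq I) (F : I -> mf_hom X Y) x :
  hom1 (\big[@hom_add R w X Y/hom_zero X Y]_(i <- s) F i) x
  = \sum_(i <- s) hom1 (F i) x.
Proof. by elim: s => [|i s IHs]; rewrite ?big_nil // !big_cons /= IHs. Qed.

Lemma homotopic_big X Y (I : Type) (s : seq I) (F G : I -> mf_hom X Y) :
  (forall i, homotopic (F i) (G i)) ->
  homotopic (\big[@hom_add R w X Y/hom_zero X Y]_(i <- s) F i)
            (\big[@hom_add R w X Y/hom_zero X Y]_(i <- s) G i).
Proof.
move=> FG; elim: s => [|i s IHs].
  by rewrite !big_nil; apply: homotopic_refl.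
by rewrite !big_cons; apply: homotopic_add.
Qed.

End Homotopies.

(** * Direct sums of matrix factorizations *)

Section DirectSumMap.
Variables (R : comNzRingType) (I : choiceType) (V W : I -> lmodType R).
Variable g : forall i, {linear V i -> W i}.

Fact dsum_map_subproof (f : dsum V) : has_finite_support (fun i => g i (f i)).
Proof.
by case: f => f [s fs]; exists s => i /fs /= ->; rewrite linear0.
Qed.
Definition dsum_map (f : dsum V) : dsum W := DSum (dsum_map_subproof f).
Fact dsum_map_linear : linear dsum_map.
Proof. by move=> a f h; apply: dsum_eq => i /=; rewrite linearP. Qed.
HB.instance Definition _ :=
  GRing.isLinear.Build R _ _ _ dsum_map dsum_map_linear.

Lemma dsum_map_inj i (v : V i) : dsum_map (dsum_inj v) = dsum_inj (g i v).
Proof.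
apply: dsum_eq => j; rewrite /= /dsum_inj /=.
have [<-|ij] := eqVneq i j; first by rewrite !dfwith_in.
by rewrite !dfwith_out // linear0.
Qed.
End DirectSumMap.

Section DirectSumMF.
Variables (R : comNzRingType) (w : R) (I : choiceType) (Y : I -> MF w).

Fact mf_dsum_phi_psi x :
  dsum_map (fun i => phi (Y i)) (dsum_map (fun i => psi (Y i)) x) = w *: x.
Proof. by apply: dsum_eq => i; apply: phi_psi. Qed.
Fact mf_dsum_psi_phi x :
  dsum_map (fun i => psi (Y i)) (dsum_map (fun i => phi (Y i)) x) = w *: x.
Proof. by apply: dsum_eq => i; apply: psi_phi. Qed.

Definition mf_dsum : MF w :=
  @MkMF R w (dsum (fun i => mf0 (Y i))) (dsum (fun i => mf1 (Y i)))
    (dsum_free (fun i => mf0_free (Y i))) (dsum_free (fun i => mf1_free (Y i)))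
    (dsum_map (fun i => phi (Y i))) (dsum_map (fun i => psi (Y i)))
    mf_dsum_phi_psi mf_dsum_psi_phi.

Definition mf_inj i : mf_hom (Y i) mf_dsum :=
  @MkHom R w (Y i) mf_dsum (@dsum_inj R I (fun i => mf0 (Y i)) i)
    (@dsum_inj R I (fun i => mf1 (Y i)) i)
    (@dsum_map_inj _ _ _ _ _ _) (@dsum_map_inj _ _ _ _ _ _).

Definition mf_pr i : mf_hom mf_dsum (Y i) :=
  @MkHom R w mf_dsum (Y i) (@dsum_pr R I (fun i => mf0 (Y i)) i)
    (@dsum_pr R I (fun i => mf1 (Y i)) i)
    (fun _ => erefl) (fun _ => erefl).

Lemma mf_dsum_lift (Z : MF w) (f : forall i, mf_hom (Y i) Z) :
  exists g : mf_hom mf_dsum Z,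
    (forall i v, hom0 g (hom0 (mf_inj i) v) = hom0 (f i) v) /\
    (forall i v, hom1 g (hom1 (mf_inj i) v) = hom1 (f i) v).
Proof.
have [g0 g0E] := dsum_lift (fun i => hom0 (f i)).
have [g1 g1E] := dsum_lift (fun i => hom1 (f i)).
have gphi x : phi Z (g1 x) = g0 (phi mf_dsum x).
  apply: (@dsum_ext _ _ _ _ (phi Z \o g1) (g0 \o phi mf_dsum)) => i v /=.
  by rewrite dsum_map_inj g0E g1E hom_phi.
have gpsi x : psi Z (g0 x) = g1 (psi mf_dsum x).
  apply: (@dsum_ext _ _ _ _ (psi Z \o g0) (g1 \o psi mf_dsum)) => i v /=.
  by rewrite dsum_map_inj g0E g1E hom_psi.
by exists (@MkHom R w mf_dsum Z g0 g1 gphi gpsi).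
Qed.

(** Homotopies on the summands can be chosen and glued by [dsum_lift], so the strict direct sum
    remains a coproduct up to homotopy. *)
Lemma mf_dsum_coproduct : is_coproduct mf_inj.
Proof.
move=> Z f; have [g [g0E g1E]] := mf_dsum_lift f.
exists g; split=> [i|g' g'P].
  by apply: homotopic_eq => v; [apply: g0E | apply: g1E].
have /all_sig[h0 /(_ _)/cid-/all_sig[h1 hE]] i := cid (g'P i).
have [l0 l0E] := dsum_lift h0.
have [l1 l1E] := dsum_lift h1.
exists l0, l1; split=> x.
  apply: (@dsum_ext _ _ _ _ (hom0 g' \- hom0 g)
    ((phi Z \o l0) \+ (l1 \o psi mf_dsum))) => i v /=.
  by rewrite [hom0 g _]g0E dsum_map_inj l0E l1E -(hE i).1.
apply: (@dsum_ext _ _ _ _ (hom1 g' \- hom1 g)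
  ((psi Z \o l1) \+ (l0 \o phi mf_dsum))) => i v /=.
by rewrite [hom1 g _]g1E dsum_map_inj l0E l1E -(hE i).2.
Qed.

End DirectSumMF.

(** * Compactness of factorizations of finite rank *)

Definition finitely_generated (R : comNzRingType) (V : lmodType R) : Prop :=
  exists (T : finType) (e : T -> V),
    forall v, exists c : T -> R, v = \sum_t c t *: e t.

Lemma dsum_fg_support (R : comNzRingType) (V : lmodType R) (I : choiceType)
    (W : I -> lmodType R) (f : {linear V -> dsum W}) :
  finitely_generated V ->
  exists s : seq I, forall v i, i \notin s -> f v i = 0.
Proof.
move=> [T [e eP]].
have /choice[s sP] t := dsum_support (f (e t)).
exists (flatten [seq s t | t <- enum T]) => v i si.
have [c ->] := eP v; pose h : {linear V -> W i} := dsum_pr i \o f.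
rewrite -[LHS]/(h _) linear_sum big1 // => t _.
rewrite linearZ /= /dsum_pr sP ?scaler0 //.
apply: contra si => si; apply/flattenP; exists (s t) => //.
by rewrite map_f // mem_enum.
Qed.

(** An arbitrary coproduct C is compared with the direct sum, where maps have components; finite
    generation makes all but finitely many of them vanish. *)
Lemma finite_rank_compact (R : comNzRingType) (w : R) (X : MF w) :
  finitely_generated (mf0 X) -> finitely_generated (mf1 X) -> compact X.
Proof.
move=> fg0 fg1 I Y C inc incP.
have [a [aE _]] := incP _ (@mf_inj _ _ _ Y).
have [b [bE _]] := mf_dsum_coproduct inc.
(* Both [b a] and the identity restrict to [inc] up to homotopy; uniqueness identifies them. *)
have ba : homotopic (hom_comp b a) (hom_id C).
  have [g [_ gU]] := incP C inc.
  apply: (@homotopic_trans _ _ _ _ _ g); last apply: homotopic_sym.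
    apply: gU => i; apply: (homotopic_trans _ (bE i)).
    apply: homotopic_trans (homotopic_compl b (aE i)).
    exact: homotopic_eq.
  by apply: gU => i; apply: homotopic_eq.
have comp_big Z Z' (k : mf_hom Z Z') (s : seq I) (F : I -> mf_hom X Z) :
    homotopic (hom_comp k (\big[@hom_add R w X Z/hom_zero X Z]_(i <- s) F i))
      (\big[@hom_add R w X Z'/hom_zero X Z']_(i <- s) hom_comp k (F i)).
  by apply: homotopic_eq => x /=;
     rewrite ?big_hom_add0 ?big_hom_add1 linear_sum.
split=> [f|s g us gs i si].
  (* The components of f are those of [a f]; the list [s] covers its even and its odd part. *)
  pose af := hom_comp a f.
  have [s0 s0P] := dsum_fg_support (hom0 af) fg0.
  have [s1 s1P] := dsum_fg_support (hom1 af) fg1.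
  pose s := undup (s0 ++ s1).
  exists s, (fun i => hom_comp (@mf_pr _ _ _ Y i) af).
  split; first exact: undup_uniq.
  have afE : homotopic af
      (\big[@hom_add R w X _/hom_zero X _]_(i <- s)
         hom_comp (mf_inj Y i) (hom_comp (mf_pr Y i) af)).
    apply: homotopic_eq => x; rewrite ?big_hom_add0 ?big_hom_add1.
      apply: (dsum_sum (undup_uniq _)) => i.
      by rewrite mem_undup mem_cat negb_or => /andP[/s0P].
    apply: (dsum_sum (undup_uniq _)) => i.
    by rewrite mem_undup mem_cat negb_or => /andP[_ /s1P].
  apply: (@homotopic_trans _ _ _ _ _ (hom_comp b af)).
    apply: (@homotopic_trans _ _ _ _ _ (hom_comp (hom_comp b a) f)).
      apply: (@homotopic_trans _ _ _ _ _ (hom_comp (hom_id C) f)).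
        exact: homotopic_eq.
      exact/homotopic_compr/homotopic_sym.
    exact: homotopic_eq.
  apply: (homotopic_trans (homotopic_compl b afE)).
  apply: (homotopic_trans (comp_big _ _ _ _ _)).
  apply: homotopic_big => i.
  apply: homotopic_trans (homotopic_compr _ (bE i)).
  exact: homotopic_eq.
(* Since [a (inc j)] is homotopic to the j-th inclusion, [a] followed by the i-th projection
   isolates [g i]. *)
have := homotopic_compl (hom_comp (mf_pr Y i) a) gs.
move=> /(homotopic_trans (homotopic_sym (comp_big _ _ _ _ _))) prg.
apply: (@homotopic_trans _ _ _ _ _ _ _ _ (homotopic_trans prg _)); last first.
  by apply: homotopic_eq => x /=; rewrite linear0 linear0.
apply: (@homotopic_trans _ _ _ _ _ 
  (\big[@hom_add R w X _/hom_zero X _]_(j <- s)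
     hom_comp (mf_pr Y i) (hom_comp (mf_inj Y j) (g j)))).
  apply: homotopic_eq => x; rewrite ?big_hom_add0 ?big_hom_add1.
    rewrite (bigD1_seq i) // big1_seq.
      exact: (esym (etrans (addr0 _) (dsum_pr_in _))).
    by move=> j /andP[ji _]; apply: dsum_pr_out.
  rewrite (bigD1_seq i) // big1_seq.
    exact: (esym (etrans (addr0 _) (dsum_pr_in _))).
  by move=> j /andP[ji _]; apply: dsum_pr_out.
apply: homotopic_big => j; apply: homotopic_sym.
apply: (@homotopic_trans _ _ _ _ _
  (hom_comp (mf_pr Y i) (hom_comp (hom_comp a (inc j)) (g j)))).
  exact: homotopic_eq.
exact/homotopic_compl/homotopic_compr/aE.
Qed.

Lemma ffun_finitely_generated (R : comNzRingType) (T : finType) :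
  finitely_generated {ffun T -> R^o}.
Proof.
exists T, (fun t => [ffun u => (u == t)%:R]) => v; exists v.
apply/ffunP => u; rewrite sum_ffunE (bigD1 u) //= !ffunE eqxx.
rewrite [X in _ + X]big1 ?addr0; first by rewrite /GRing.scale /= mulr1.
by move=> t tu; rewrite !ffunE eq_sym (negPf tu) scaler0.
Qed.

(** * Cones and the octahedral axiom *)

Section PairMap.
Variables (R : comNzRingType) (U V W : lmodType R).
Variables (f : {linear U -> V}) (g : {linear U -> W}).

Definition pair_map (u : U) : (V * W)%type := (f u, g u).
Fact pair_map_linear : linear pair_map.
Proof. by move=> a u v; rewrite /pair_map !linearP. Qed.
HB.instance Definition _ :=
  GRing.isLinear.Build R _ _ _ pair_map pair_map_linear.
End PairMap.

Lemma pair_ext (A B : Type) (p q : A * B) : p.1 = q.1 -> p.2 = q.2 -> p = q.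
Proof. by case: p q => [a b] [c d] /= -> ->. Qed.

Lemma linE (R : comNzRingType) (U V : lmodType R) (f : {linear U -> V}) :
  (forall x y, f (x + y) = f x + f y) * (forall x, f (- x) = - f x) * (f 0 = 0).
Proof. by split; [split=> *; rewrite ?linearD ?linearN | rewrite linear0]. Qed.

Lemma linZE (R : comNzRingType) (U V : lmodType R) (f : {linear U -> V}) a x :
  f (a *: x) = a *: f x.
Proof. exact: linearZ. Qed.

Section Cones.
Variables (R : comNzRingType) (w : R).

Lemma mf_iso_cone (X Y : MF w) (f g : mf_hom X Y) :
  hom0 f =1 hom0 g -> hom1 f =1 hom1 g -> mf_iso (mf_cone f) (mf_cone g).
Proof.
move=> fg0 fg1.
have ephi x : phi (mf_cone g) x = phi (mf_cone f) x.
  by rewrite /= /cone_phi fg0.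
have epsi x : psi (mf_cone g) x = psi (mf_cone f) x.
  by rewrite /= /cone_psi fg1.
exists (@MkHom R w (mf_cone f) (mf_cone g) idfun idfun ephi epsi).
exists (@MkHom R w (mf_cone g) (mf_cone f) idfun idfun
  (fun x => esym (ephi x)) (fun x => esym (epsi x))).
by split; apply: homotopic_eq.
Qed.

(* [s] is a split monomorphism with cokernel [Y]. *)
Lemma mf_iso_split_cone (W Y : MF w) (s t : mf_hom W W) (j : mf_hom Y W)
    (q : mf_hom W Y) :
  (forall x, hom0 t (hom0 s x) = x) -> (forall x, hom1 t (hom1 s x) = x) ->
  (forall y, hom0 q (hom0 j y) = y) -> (forall y, hom1 q (hom1 j y) = y) ->
  (forall x, x = hom0 s (hom0 t x) + hom0 j (hom0 q x)) ->
  (forall x, x = hom1 s (hom1 t x) + hom1 j (hom1 q x)) ->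
  mf_iso (mf_cone s) Y.
Proof.
move=> ts0 ts1 qj0 qj1 st0 st1.
have qs0 x : hom0 q (hom0 s x) = 0.
  have := congr1 (hom0 q) (st0 (hom0 s x)).
  rewrite linearD ts0 qj0 => /eqP; rewrite addrC -subr_eq subrr eq_sym.
  by move=> /eqP.
have qs1 x : hom1 q (hom1 s x) = 0.
  have := congr1 (hom1 q) (st1 (hom1 s x)).
  rewrite linearD ts1 qj1 => /eqP; rewrite addrC -subr_eq subrr eq_sym.
  by move=> /eqP.
have Qphi x : phi Y ((hom1 q \o fst) x) = (hom0 q \o fst) (phi (mf_cone s) x).
  by rewrite /= linearD qs0 addr0 hom_phi.
have Qpsi x : psi Y ((hom0 q \o fst) x) = (hom1 q \o fst) (psi (mf_cone s) x).
  by rewrite /= linearD qs1 addr0 hom_psi.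
pose Q := @MkHom R w (mf_cone s) Y _ _ Qphi Qpsi.
have Jphi x : phi (mf_cone s) (pair_map (hom1 j) \0 x)
              = pair_map (hom0 j) \0 (phi Y x).
  by apply: pair_ext; rewrite /= linear0 ?oppr0 // addr0 hom_phi.
have Jpsi x : psi (mf_cone s) (pair_map (hom0 j) \0 x)
              = pair_map (hom1 j) \0 (psi Y x).
  by apply: pair_ext; rewrite /= linear0 ?oppr0 // addr0 hom_psi.
pose J := @MkHom R w Y (mf_cone s) _ _ Jphi Jpsi.
exists Q, J; split; last by apply: homotopic_eq => y /=.
(* The homotopy between the identity and [J Q] is (x, y) |-> (0, t x). *)
apply: homotopic_sym.
exists (pair_map \0 (hom0 t \o fst)), (pair_map \0 (hom1 t \o fst)).
split=> -[x y]; apply: pair_ext => /=.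
- by rewrite {1}[x]st0 addrK !linear0 !add0r addr0.
- by rewrite subr0 linearD ts1 hom_psi; zmod.
- by rewrite {1}[x]st1 addrK !linear0 !add0r addr0.
- by rewrite subr0 linearD ts0 hom_phi; zmod.
Qed.

Section ConeComp.
Variables (A B C : MF w) (f : mf_hom A B) (g : mf_hom B C).

Let X := mf_shift (mf_cone g).
Let d0 : {linear (mf1 C * mf0 B)%type -> (mf0 B * mf1 A)%type} :=
  pair_map snd \0.
Let d1 : {linear (mf0 C * mf1 B)%type -> (mf1 B * mf0 A)%type} :=
  pair_map snd \0.
Fact cone_comp_phi x : phi (mf_cone f) (d1 x) = d0 (phi X x).
Proof. by apply: pair_ext; rewrite /= linear0 ?oppr0 // addr0 opprK. Qed.
Fact cone_comp_psi x : psi (mf_cone f) (d0 x) = d1 (psi X x).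
Proof. by apply: pair_ext; rewrite /= linear0 ?oppr0 // addr0 opprK. Qed.
(** The connecting map (c, b) |-> (b, 0) from cone(g)[-1], which is the shift [1] by
    2-periodicity. *)
Definition cone_comp : mf_hom X (mf_cone f) :=
  @MkHom R w X (mf_cone f) d0 d1 cone_comp_phi cone_comp_psi.

(* The octahedral axiom for [hom_comp g f]. *)
Lemma mf_iso_cone_comp : mf_iso (mf_cone cone_comp) (mf_cone (hom_comp g f)).
Proof.
(* The cone of [cone_comp] contains B twice, and these copies cancel: [i] and [p] identify the rest
   with the cone of [g f], and the homotopy moves the first copy of B to the second. *)
pose i0 : {linear (mf0 C * mf1 A)%type -> mf0 (mf_cone cone_comp)} :=
  pair_map (pair_map \0 (\- snd)) (pair_map fst (hom1 f \o snd)).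
pose i1 : {linear (mf1 C * mf0 A)%type -> mf1 (mf_cone cone_comp)} :=
  pair_map (pair_map \0 (\- snd)) (pair_map fst (hom0 f \o snd)).
pose p0 : {linear mf0 (mf_cone cone_comp) -> (mf0 C * mf1 A)%type} :=
  pair_map ((fst \o snd) \- (hom0 g \o (fst \o fst))) (\- (snd \o fst)).
pose p1 : {linear mf1 (mf_cone cone_comp) -> (mf1 C * mf0 A)%type} :=
  pair_map ((fst \o snd) \- (hom1 g \o (fst \o fst))) (\- (snd \o fst)).
pose lin := (linE (phi A), linE (psi A), linE (phi B), linE (psi B),
  linE (phi C), linE (psi C), linE (hom0 f), linE (hom1 f), linE (hom0 g),
  linE (hom1 g)).
pose K := mf_cone cone_comp; pose G := mf_cone (hom_comp g f).
have iphi x : phi K (i1 x) = i0 (phi G x).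
  by apply: pair_ext; apply: pair_ext; rewrite /= ?lin ?hom_psi; zmod.
have ipsi x : psi K (i0 x) = i1 (psi G x).
  by apply: pair_ext; apply: pair_ext; rewrite /= ?lin ?hom_phi; zmod.
have pphi x : phi G (p1 x) = p0 (phi K x).
  by apply: pair_ext; rewrite /= ?lin ?hom_phi; zmod.
have ppsi x : psi G (p0 x) = p1 (psi K x).
  by apply: pair_ext; rewrite /= ?lin ?hom_psi; zmod.
pose i := @MkHom R w G K i0 i1 iphi ipsi.
pose p := @MkHom R w K G p0 p1 pphi ppsi.
exists p, i; split; last first.
  apply: homotopic_eq => x; apply: pair_ext; rewrite /= ?lin ?opprK //;
  by rewrite oppr0 addr0.
apply: homotopic_sym.
pose h0 : {linear mf0 K -> mf1 K} := pair_map \0 (pair_map \0 (fst \o fst)).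
pose h1 : {linear mf1 K -> mf0 K} := pair_map \0 (pair_map \0 (fst \o fst)).
by exists h0, h1; split=> x; apply: pair_ext; apply: pair_ext;
   rewrite /= ?lin; zmod.
Qed.
End ConeComp.
End Cones.

(** Brings a known equation c = d into a goal, leaving an identity that [zmod] can decide. *)
Lemma eq_from_sub (V : zmodType) (a b c d : V) :
  c = d -> a - b = c - d -> a = b.
Proof. by move=> -> /eqP; rewrite subrr subr_eq0 => /eqP. Qed.

(** * Closure of localizing subcategories under retracts *)

Section LocalizingSubcategory.
Variables (R : comNzRingType) (w : R) (P : MF w -> Prop).
Hypothesis P_loc : localizing P.
Implicit Types X Y Z : MF w.

Lemma loc_iso X Y : mf_iso X Y -> P X -> P Y.
Proof. by case: P_loc => H _ _ _; apply: H. Qed.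

Lemma loc_shift X : P X -> P (mf_shift X).
Proof. by case: P_loc => _ H _ _; apply: H. Qed.

Lemma loc_cone X Y (f : mf_hom X Y) : P X -> P Y -> P (mf_cone f).
Proof. by case: P_loc => _ _ H _; apply: H. Qed.

Lemma loc_dsum (I : choiceType) (Y : I -> MF w) :
  (forall i, P (Y i)) -> P (mf_dsum Y).
Proof.
by case: P_loc => _ _ _ H; apply: (H I Y _ _ (@mf_dsum_coproduct R w I Y)).
Qed.

Lemma loc_cone_comp X Y Z (f : mf_hom X Y) (g : mf_hom Y Z) :
  P (mf_cone f) -> P (mf_cone g) -> P (mf_cone (hom_comp g f)).
Proof.
move=> Pf Pg; apply: loc_iso (mf_iso_cone_comp f g) _.
exact: loc_cone (loc_shift Pg) Pf.
Qed.

(** A contractible X is isomorphic to the empty direct sum, which lies in P. *)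
Lemma loc_contractible X : homotopic (hom_id X) (hom_zero X X) -> P X.
Proof.
move=> X0; have P0 : P (mf_dsum (fun v : void => X)) by apply: loc_dsum => -[].
apply: loc_iso P0; exists (hom_zero _ _), (hom_zero _ _); split; last first.
  apply: homotopic_trans (homotopic_sym X0); exact: homotopic_eq.
by apply: homotopic_eq => x; apply: dsum_eq => -[].
Qed.

Lemma loc_cone_id X : P (mf_cone (hom_id X)).
Proof.
apply: loc_contractible.
exists (pair_map \0 fst), (pair_map \0 fst).
by split=> -[x y]; apply: pair_ext; rewrite /= ?linE; zmod.
Qed.

Lemma loc_strict_retract Y Z (i : mf_hom Y Z) (r : mf_hom Z Y) :
  (forall y, hom0 r (hom0 i y) = y) -> (forall y, hom1 r (hom1 i y) = y) ->
  P Z -> P Y.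
Proof.
move=> ri0 ri1 PZ; pose W := mf_dsum (fun _ : nat => Z).
have PW : P W by exact: loc_dsum.
pose inj m : mf_hom Z W := mf_inj (fun _ : nat => Z) m.
pose e := hom_comp i r.
have e'phi z : phi Z ((idfun \- hom1 e) z) = (idfun \- hom0 e) (phi Z z).
  by rewrite /= linearB /= !hom_phi.
have e'psi z : psi Z ((idfun \- hom0 e) z) = (idfun \- hom1 e) (psi Z z).
  by rewrite /= linearB /= !hom_psi.
pose e' := @MkHom R w Z Z _ _ e'phi e'psi.
(* Eilenberg swindle: on Z (+) Z (+) ..., [s] shifts the summand
   Y of each copy of Z and fixes its complement; its cokernel is the first copy of Y. *)
have [s [s0E s1E]] := mf_dsum_lift (fun m =>
  hom_add (hom_comp (inj m) e') (hom_comp (inj m.+1) e)).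
(* The left inverse of [s] shifts the summands Y back and kills the first one. *)
have [t [t0E t1E]] := mf_dsum_lift (fun m =>
  hom_add (hom_comp (inj m) e')
    (if m is m'.+1 then hom_comp (inj m') e else hom_zero Z W)).
have ee0 z : hom0 e (z - hom0 e z) = 0 by rewrite linearB /= ri0 subrr.
have ee1 z : hom1 e (z - hom1 e z) = 0 by rewrite linearB /= ri1 subrr.
pose j := hom_comp (inj 0%N) i.
pose q := hom_comp r (mf_pr (fun _ : nat => Z) 0%N).
have pr0 m v : hom0 (mf_pr (fun _ : nat => Z) 0%N) (hom0 (inj m) v)
    = if m is 0%N then v else 0.
  by case: m => [|m]; [apply: dsum_pr_in | apply: dsum_pr_out].
have pr1 m v : hom1 (mf_pr (fun _ : nat => Z) 0%N) (hom1 (inj m) v)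
    = if m is 0%N then v else 0.
  by case: m => [|m]; [apply: dsum_pr_in | apply: dsum_pr_out].
have {}s0E m v : hom0 s (hom0 (inj m) v)
    = hom0 (inj m) (v - hom0 e v) + hom0 (inj m.+1) (hom0 e v) by exact: s0E.
have {}s1E m v : hom1 s (hom1 (inj m) v)
    = hom1 (inj m) (v - hom1 e v) + hom1 (inj m.+1) (hom1 e v) by exact: s1E.
have {}t0E m v : hom0 t (hom0 (inj m) v) = hom0 (inj m) (v - hom0 e v)
    + (if m is m'.+1 then hom0 (inj m') (hom0 e v) else 0).
  by rewrite [LHS]t0E; case: m.
have {}t1E m v : hom1 t (hom1 (inj m) v) = hom1 (inj m) (v - hom1 e v)
    + (if m is m'.+1 then hom1 (inj m') (hom1 e v) else 0).
  by rewrite [LHS]t1E; case: m.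
have e0e z : hom0 e (hom0 e z) = hom0 e z by rewrite /= ri0.
have e1e z : hom1 e (hom1 e z) = hom1 e z by rewrite /= ri1.
apply: (loc_iso (@mf_iso_split_cone _ _ W Y s t j q _ _ _ _ _ _)).
- apply: (@dsum_ext _ _ _ _ (hom0 t \o hom0 s) idfun) => m v.
  transitivity (hom0 t (hom0 s (hom0 (inj m) v))) => //.
  rewrite s0E (linearD (hom0 t)) !t0E ee0 e0e subrr subr0 linear0 add0r.
  case: m => [|m]; first by rewrite addr0 -linearD subrK.
  by rewrite linear0 addr0 -linearD subrK.
- apply: (@dsum_ext _ _ _ _ (hom1 t \o hom1 s) idfun) => m v.
  transitivity (hom1 t (hom1 s (hom1 (inj m) v))) => //.
  rewrite s1E (linearD (hom1 t)) !t1E ee1 e1e subrr subr0 linear0 add0r.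
  case: m => [|m]; first by rewrite addr0 -linearD subrK.
  by rewrite linear0 addr0 -linearD subrK.
- move=> y; transitivity (hom0 r (hom0 (mf_pr (fun _ : nat => Z) 0%N)
    (hom0 (inj 0%N) (hom0 i y)))) => //.
  by rewrite pr0 ri0.
- move=> y; transitivity (hom1 r (hom1 (mf_pr (fun _ : nat => Z) 0%N)
    (hom1 (inj 0%N) (hom1 i y)))) => //.
  by rewrite pr1 ri1.
- apply: (@dsum_ext _ _ _ _ idfun
    ((hom0 s \o hom0 t) \+ (hom0 j \o hom0 q))) => m v.
  transitivity (hom0 s (hom0 t (hom0 (inj m) v))
    + hom0 j (hom0 r (hom0 (mf_pr _ 0%N) (hom0 (inj m) v)))) => //.
  rewrite pr0 t0E (linearD (hom0 s)) s0E ee0 subr0 linear0 addr0.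
  case: m => [|m]; first by rewrite linear0 addr0 -linearD subrK.
  by rewrite s0E e0e subrr !linear0 add0r addr0 -linearD subrK.
- apply: (@dsum_ext _ _ _ _ idfun
    ((hom1 s \o hom1 t) \+ (hom1 j \o hom1 q))) => m v.
  transitivity (hom1 s (hom1 t (hom1 (inj m) v))
    + hom1 j (hom1 r (hom1 (mf_pr _ 0%N) (hom1 (inj m) v)))) => //.
  rewrite pr1 t1E (linearD (hom1 s)) s1E ee1 subr0 linear0 addr0.
  case: m => [|m]; first by rewrite linear0 addr0 -linearD subrK.
  by rewrite s1E e1e subrr !linear0 add0r addr0 -linearD subrK.
exact: loc_cone.
Qed.

Lemma loc_retract Y Z (i : mf_hom Y Z) (r : mf_hom Z Y) :
  homotopic (hom_comp r i) (hom_id Y) -> P Z -> P Y.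
Proof.
move=> /homotopic_sym[h0 [h1 [hE0 hE1]]] PZ.
(* Adding the contractible cone of the identity of Y makes the retraction
   strict. *)
pose Z' := mf_cone (hom_zero (mf_shift (mf_cone (hom_id Y))) Z).
have PZ' : P Z' by apply: loc_cone => //; apply/loc_shift/loc_cone_id.
pose i0 : {linear mf0 Y -> mf0 Z'} := pair_map (hom0 i) (pair_map idfun \0).
pose i1 : {linear mf1 Y -> mf1 Z'} := pair_map (hom1 i) (pair_map idfun \0).
(* The defect [id - r i] on the added copy of Y makes the composite strictly the identity; the
   homotopy on the other half of the cone makes the map commute with the differentials. *)
pose r0 : {linear mf0 Z' -> mf0 Y} := (hom0 r \o fst)
  \+ ((fst \o snd) \- (hom0 r \o (hom0 i \o (fst \o snd))))
  \+ (h1 \o (snd \o snd)).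
pose r1 : {linear mf1 Z' -> mf1 Y} := (hom1 r \o fst)
  \+ ((fst \o snd) \- (hom1 r \o (hom1 i \o (fst \o snd))))
  \+ (h0 \o (snd \o snd)).
pose lin := (linE (phi Y), linE (psi Y), linE (phi Z), linE (psi Z),
  linE (hom0 r), linE (hom1 r), linE (hom0 i), linE (hom1 i), linE h0, linE h1).
have iphi x : phi Z' (i1 x) = i0 (phi Y x).
  by apply: pair_ext; [|apply: pair_ext]; rewrite /= ?lin ?hom_phi; zmod.
have ipsi x : psi Z' (i0 x) = i1 (psi Y x).
  by apply: pair_ext; [|apply: pair_ext]; rewrite /= ?lin ?hom_psi; zmod.
have rphi x : phi Y (r1 x) = r0 (phi Z' x).
  have := hE0 x.2.2; rewrite /= ?lin ?hom_phi => hE.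
  by apply: (eq_from_sub (esym hE)); zmod.
have rpsi x : psi Y (r0 x) = r1 (psi Z' x).
  have := hE1 x.2.2; rewrite /= ?lin ?hom_psi => hE.
  by apply: (eq_from_sub (esym hE)); zmod.
apply: (@loc_strict_retract Y Z' (@MkHom R w Y Z' i0 i1 iphi ipsi)
  (@MkHom R w Z' Y r0 r1 rphi rpsi)) => // y.
  by rewrite /= linear0 addr0 addrC subrK.
by rewrite /= linear0 addr0 addrC subrK.
Qed.

End LocalizingSubcategory.

(** * Koszul objects of regular sequences *)

Section IdealMultiples.
Variable R : comNzRingType.
Implicit Types (s : seq R) (V W : lmodType R).

(* v lies in (s)V; this replaces the quotient modules V / (s)V. *)
Fixpoint in_ideal s V (v : V) : Prop :=
  match s with
  | [::] => v = 0
  | a :: s' => exists u : V, in_ideal s' (v - a *: u)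
  end.

(* A regular sequence, listed from its last element to its first. *)
Fixpoint regular_on s V : Prop :=
  match s with
  | [::] => True
  | a :: s' =>
      regular_on s' V /\ forall v : V, in_ideal s' (a *: v) -> in_ideal s' v
  end.

Lemma in_ideal0 s V : in_ideal s (0 : V).
Proof.
elim: s => [|a s IHs] //=.
by exists 0; rewrite scaler0 subr0.
Qed.

Lemma in_idealD s V (u v : V) :
  in_ideal s u -> in_ideal s v -> in_ideal s (u + v).
Proof.
elim: s u v => [|a s IHs] u v /=; first by move=> -> ->; rewrite addr0.
move=> [u' uI] [v' vI]; exists (u' + v').
have -> : u + v - a *: (u' + v') = u - a *: u' + (v - a *: v').
  by rewrite scalerDr; zmod.
exact: IHs.
Qed.

Lemma in_idealZ s V (c : R) (v : V) : in_ideal s v -> in_ideal s (c *: v).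
Proof.
elim: s v => [|a s IHs] v /=; first by move=> ->; rewrite scaler0.
move=> [v' vI]; exists (c *: v').
by rewrite scalerA mulrC -scalerA -scalerBr; apply: IHs.
Qed.

Lemma in_idealN s V (v : V) : in_ideal s v -> in_ideal s (- v).
Proof. by rewrite -scaleN1r; apply: in_idealZ. Qed.

Lemma in_idealB s V (u v : V) :
  in_ideal s u -> in_ideal s v -> in_ideal s (u - v).
Proof. by move=> uI vI; apply/in_idealD/in_idealN. Qed.

Lemma in_ideal_cons a s V (v : V) : in_ideal s v -> in_ideal (a :: s) v.
Proof. by exists 0; rewrite scaler0 subr0. Qed.

Lemma in_ideal_mem a s V (v : V) : a \in s -> in_ideal s (a *: v).
Proof.
elim: s => // b s IHs; rewrite inE => /orP[/eqP ->|/IHs]; last first.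
  exact: in_ideal_cons.
by exists v; rewrite subrr; apply: in_ideal0.
Qed.

Lemma in_ideal_linear s V W (f : {linear V -> W}) (v : V) :
  in_ideal s v -> in_ideal s (f v).
Proof.
elim: s v => [|a s IHs] v /=; first by move=> ->; rewrite linear0.
by move=> [u uI]; exists (f u); rewrite -linearZ -linearB; apply: IHs.
Qed.

End IdealMultiples.

Section Koszul.
Variables (R : comNzRingType) (w : R).
Implicit Types (X F : MF w) (s : seq R).

(** The head of [s] gives the outermost cone; in the order of [regular_on] it is the last element of
    the sequence. *)
Fixpoint kos s X : MF w :=
  if s is a :: s' then mf_cone (hom_scale a (kos s' X)) else X.

(* The map Hom(F, K) -> Hom(F, X / sX) induced by [q] is a surjective
   quasi-isomorphism, so that K represents F |-> H^0 Hom(F, X / sX). Only even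
   [f] occur: for odd ones replace [F] by its shift. *)
Definition resolves s (K X : MF w) (q0 : {linear mf0 K -> mf0 X})
    (q1 : {linear mf1 K -> mf1 X}) : Prop :=
  forall (F : MF w)
    (g0 : {linear mf0 F -> mf1 K}) (g1 : {linear mf1 F -> mf0 K})
    (f0 : {linear mf0 F -> mf0 X}) (f1 : {linear mf1 F -> mf1 X}),
    (forall v, phi K (g0 v) + g1 (psi F v) = 0) ->
    (forall v, psi K (g1 v) + g0 (phi F v) = 0) ->
    (forall v, in_ideal s (q1 (g0 v) - (psi X (f0 v) - f1 (psi F v)))) ->
    (forall v, in_ideal s (q0 (g1 v) - (phi X (f1 v) - f0 (phi F v)))) ->
  exists (e0 : {linear mf0 F -> mf0 K}) (e1 : {linear mf1 F -> mf1 K}),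
    [/\ forall v, psi K (e0 v) - e1 (psi F v) = g0 v,
        forall v, phi K (e1 v) - e0 (phi F v) = g1 v,
        forall v, in_ideal s (q0 (e0 v) - f0 v)
      & forall v, in_ideal s (q1 (e1 v) - f1 v)].

Definition closed_mod s (X Y : MF w) (q0 : {linear mf0 X -> mf0 Y})
    (q1 : {linear mf1 X -> mf1 Y}) : Prop :=
  (forall v, in_ideal s (phi Y (q1 v) - q0 (phi X v))) /\
  (forall v, in_ideal s (psi Y (q0 v) - q1 (psi X v))).

(** By freeness the pointwise quotients by [a] can be chosen linearly in v. *)
Lemma lift_mod a s (U W : lmodType R) (b : {linear U -> W}) :
  free_module U -> (forall v, in_ideal (a :: s) (b v)) ->
  exists c : {linear U -> W}, forall v, in_ideal s (b v - a *: c v).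
Proof.
move=> freeU bI.
apply: (free_section (Q := fun v c => in_ideal s (b v - a *: c))) => //.
split=> [|c v z v' z' vz vz'].
  by rewrite linear0 scaler0 subr0; apply: in_ideal0.
have -> : b (c *: v + v') - a *: (c *: z + z')
    = c *: (b v - a *: z) + (b v' - a *: z').
  rewrite linearP scalerBr !scalerDr !scalerA (mulrC a); zmod.
by apply: in_idealD => //; apply: in_idealZ.
Qed.

Lemma kos_resolves s X :
  regular_on s (mf0 X) -> regular_on s (mf1 X) ->
  exists (q0 : {linear mf0 (kos s X) -> mf0 X})
         (q1 : {linear mf1 (kos s X) -> mf1 X}),
    closed_mod s q0 q1 /\ resolves s q0 q1.
Proof.
elim: s => [|a s IHs] /=.
  move=> _ _; exists idfun, idfun; split.
    by split=> v; rewrite /= subrr.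
  move=> F g0 g1 f0 f1 _ _ /= gE0 gE1; exists f0, f1.
  split=> v; rewrite /= ?subrr //; symmetry; apply/eqP; rewrite -subr_eq0.
    by apply/eqP.
  by apply/eqP.
move=> [reg0 reg_a0] [reg1 reg_a1].
have [q0 [q1 [[qphi qpsi] qP]]] := IHs reg0 reg1.
set K := kos s X in q0 q1 qphi qpsi qP *.
exists (q0 \o fst), (q1 \o fst); split.
  split=> -[y z] /=; rewrite /hom_scale_fun linearD linearZ /=.
    exists (- q0 z); rewrite scalerN.
    by rewrite (_ : _ - - _ = phi X (q1 y) - q0 (phi K y)) //; zmod.
  exists (- q1 z); rewrite scalerN.
  by rewrite (_ : _ - - _ = psi X (q0 y) - q1 (psi K y)) //; zmod.
move=> F g0 g1 f0 f1 closed0 closed1 compat0 compat1.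
have [b0 b0P] := lift_mod (b := (q1 \o (fst \o g0))
  \- ((psi X \o f0) \- (f1 \o psi F))) (mf0_free F) compat0.
have [b1 b1P] := lift_mod (b := (q0 \o (fst \o g1))
  \- ((phi X \o f1) \- (f0 \o phi F))) (mf1_free F) compat1.
have {closed0} closed0 v :
    phi K (g0 v).1 + a *: (g0 v).2 + (g1 (psi F v)).1 = 0
    /\ - psi K (g0 v).2 + (g1 (psi F v)).2 = 0.
  by split; [have := congr1 fst (closed0 v) | have := congr1 snd (closed0 v)].
have {closed1} closed1 v :
    psi K (g1 v).1 + a *: (g1 v).2 + (g0 (phi F v)).1 = 0
    /\ - phi K (g1 v).2 + (g0 (phi F v)).2 = 0.
  by split; [have := congr1 fst (closed1 v) | have := congr1 snd (closed1 v)].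
pose lin := (linE (phi X), linE (psi X), linE (phi K), linE (psi K),
  linE (phi F), linE (psi F), linE q0, linE q1, linE g0, linE g1, linE f0,
  linE f1, linE b0, linE b1).
have [|||| c1 [c0 [/= c0E c1E c1q c0q]]] :=
    qP (mf_shift F) (\- (snd \o g1)) (\- (snd \o g0)) b1 b0.
- move=> v /=; rewrite -[RHS](closed1 v).2 ?lin /=; zmod.
- move=> v /=; rewrite -[RHS](closed0 v).2 ?lin /=; zmod.
(* After multiplication by [a], the claim follows by applying d to q g' - d f = a b; the terms w f
   coming from d^2 cancel. *)
- move=> v; apply: reg_a1 => /=.
  have A := in_ideal_linear (psi X) (b1P v).
  have E := congr1 q1 (closed1 v).1.
  have := in_idealB (in_idealD A (b0P (phi F v))) (qpsi (g1 v).1).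
  congr (in_ideal _ _); apply: (eq_from_sub E).
  rewrite /= ?lin !psi_phi !linearZ /= !(scalerDr, scalerN) ?lin; zmod.
- move=> v; apply: reg_a0 => /=.
  have A := in_ideal_linear (phi X) (b0P v).
  have E := congr1 q0 (closed0 v).1.
  have := in_idealB (in_idealD A (b1P (psi F v))) (qphi (g0 v).1).
  congr (in_ideal _ _); apply: (eq_from_sub E).
  rewrite /= ?lin !phi_psi !linearZ /= !(scalerDr, scalerN) ?lin; zmod.
pose lin' := (lin, linE c0, linE c1).
have [|||| e0 [e1 [/= e0E e1E e0q e1q]]] :=
    qP F ((fst \o g0) \- (hom1 (hom_scale a K) \o c0))
         ((fst \o g1) \- (hom0 (hom_scale a K) \o c1)) f0 f1.
- move=> v; have := (closed0 v).1; rewrite -[(g0 v).2]opprK -c1E.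
  move=> <-; rewrite /= /hom_scale_fun ?lin' !linearZ /= !(scalerDr, scalerN).
  zmod.
- move=> v; have := (closed1 v).1; rewrite -[(g1 v).2]opprK -c0E.
  move=> <-; rewrite /= /hom_scale_fun ?lin' !linearZ /= !(scalerDr, scalerN).
  zmod.
- move=> v; have := in_idealB (b0P v) (in_idealZ a (c0q v)).
  congr (in_ideal _ _).
  rewrite /= /hom_scale_fun ?lin' !linearZ /= !(scalerDr, scalerN).
  zmod.
- move=> v; have := in_idealB (b1P v) (in_idealZ a (c1q v)).
  congr (in_ideal _ _).
  rewrite /= /hom_scale_fun ?lin' !linearZ /= !(scalerDr, scalerN).
  zmod.
exists (pair_map e0 c0), (pair_map e1 c1); split=> v.
- apply: pair_ext; first by apply: (eq_from_sub (e0E v)) => /=; zmod.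
  by apply: (eq_from_sub (esym (c1E v))); rewrite /= ?lin'; zmod.
- apply: pair_ext; first by apply: (eq_from_sub (e1E v)) => /=; zmod.
  by apply: (eq_from_sub (esym (c0E v))); rewrite /= ?lin'; zmod.
- exact: in_ideal_cons (e0q v).
- exact: in_ideal_cons (e1q v).
Qed.

End Koszul.

(** * Koszul objects in a localizing subcategory *)

Section KoszulLocalizing.
Variables (R : comNzRingType) (w : R) (P : MF w -> Prop).
Hypothesis P_loc : localizing P.
Implicit Types X Y : MF w.

Lemma loc_kos s X : P X -> P (kos s X).
Proof. by move=> PX; elim: s => //= a s IHs; apply: loc_cone. Qed.

Lemma loc_cone_exp a X n :
  P (mf_cone (hom_scale a X)) -> P (mf_cone (hom_scale (a ^+ n.+1) X)).
Proof.
move=> Pa; elim: n => [|n IHn]; first by rewrite expr1.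
apply: (loc_iso P_loc) (loc_cone_comp P_loc Pa IHn).
by apply: mf_iso_cone => v; rewrite /= /hom_scale_fun scalerA -exprSr.
Qed.

(** A null-homotopy h of f splits the inclusion of X into cone(f): the retraction is (x, y) |-> x +
    h y. *)
Lemma loc_cone_null X (f : mf_hom X X) :
  homotopic f (hom_zero X X) -> P (mf_cone f) -> P X.
Proof.
move=> [h0 [h1 [hE0 hE1]]].
pose i0 : {linear mf0 X -> mf0 (mf_cone f)} := pair_map idfun \0.
pose i1 : {linear mf1 X -> mf1 (mf_cone f)} := pair_map idfun \0.
pose r0 : {linear mf0 (mf_cone f) -> mf0 X} := fst \+ (h1 \o snd).
pose r1 : {linear mf1 (mf_cone f) -> mf1 X} := fst \+ (h0 \o snd).
pose lin := (linE (phi X), linE (psi X), linE (hom0 f), linE (hom1 f),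
  linE h0, linE h1).
have iphi x : phi (mf_cone f) (i1 x) = i0 (phi X x).
  by apply: pair_ext; rewrite /= ?lin; zmod.
have ipsi x : psi (mf_cone f) (i0 x) = i1 (psi X x).
  by apply: pair_ext; rewrite /= ?lin; zmod.
have rphi x : phi X (r1 x) = r0 (phi (mf_cone f) x).
  by apply: (eq_from_sub (esym (hE0 x.2))); rewrite /= ?lin; zmod.
have rpsi x : psi X (r0 x) = r1 (psi (mf_cone f) x).
  by apply: (eq_from_sub (esym (hE1 x.2))); rewrite /= ?lin; zmod.
apply: (@loc_retract _ _ _ P_loc X (mf_cone f)
  (@MkHom R w X (mf_cone f) i0 i1 iphi ipsi)
  (@MkHom R w (mf_cone f) X r0 r1 rphi rpsi)).
by apply: homotopic_eq => x; rewrite /= ?lin addr0.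
Qed.

Lemma loc_of_kos s X :
  (forall a, a \in s -> exists n, null_scalar w (a ^+ n)) ->
  P (kos s X) -> P X.
Proof.
elim: s => //= a s IHs sN PK; apply: IHs => [b bs|].
  by apply: sN; rewrite inE bs orbT.
(* The exponent is raised to n + 1, because [loc_cone_exp] starts at exponent 1. *)
have [|n an] := sN a; first exact: mem_head.
apply: (@loc_cone_null (kos s X) (hom_scale (a ^+ n.+1) (kos s X))).
  by rewrite exprS; apply: null_scalarM an _.
exact: loc_cone_exp.
Qed.

(** The resolution property turns data modulo (s) into strict data between Koszul objects: [a] and
    [b] lift to closed maps i and r, and [h] lifts to a homotopy from r i to the identity. *)
Lemma loc_kos_retract s X Y
    (a0 : {linear mf0 X -> mf0 Y}) (a1 : {linear mf1 X -> mf1 Y})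
    (b0 : {linear mf0 Y -> mf0 X}) (b1 : {linear mf1 Y -> mf1 X})
    (h0 : {linear mf0 X -> mf1 X}) (h1 : {linear mf1 X -> mf0 X}) :
  regular_on s (mf0 X) -> regular_on s (mf1 X) ->
  regular_on s (mf0 Y) -> regular_on s (mf1 Y) ->
  closed_mod s a0 a1 -> closed_mod s b0 b1 ->
  (forall v, in_ideal s (b0 (a0 v) - v - (phi X (h0 v) + h1 (psi X v)))) ->
  (forall v, in_ideal s (b1 (a1 v) - v - (psi X (h1 v) + h0 (phi X v)))) ->
  P Y -> P (kos s X).
Proof.
move=> X0r X1r Y0r Y1r [aphi apsi] [bphi bpsi] hE0 hE1 /(loc_kos s) PY.
have [q0 [q1 [[qphi qpsi] qP]]] := kos_resolves X0r X1r.
have [p0 [p1 [[pphi ppsi] pP]]] := kos_resolves Y0r Y1r.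
set K := kos s X in q0 q1 qphi qpsi qP *.
set L := kos s Y in p0 p1 pphi ppsi pP PY.
pose lin := (linE (phi X), linE (psi X), linE (phi K), linE (psi K),
  linE (phi Y), linE (psi Y), linE (phi L), linE (psi L), linE q0, linE q1,
  linE p0, linE p1, linE a0, linE a1, linE b0, linE b1, linE h0, linE h1).
(* With g = 0 the resolution property yields closed lifts. *)
have [|||| i0 [i1 [/= ipsi iphi i0E i1E]]] :=
    pP K \0 \0 (a0 \o q0) (a1 \o q1).
- by move=> v /=; rewrite linear0 addr0.
- by move=> v /=; rewrite linear0 addr0.
- move=> v; have A := in_ideal_linear a1 (qpsi v).
  have := in_idealN (in_idealD A (apsi (q0 v))).
  by congr (in_ideal _ _); rewrite /= ?lin; zmod.
- move=> v; have A := in_ideal_linear a0 (qphi v).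
  have := in_idealN (in_idealD A (aphi (q1 v))).
  by congr (in_ideal _ _); rewrite /= ?lin; zmod.
have [|||| r0 [r1 [/= rpsi rphi r0E r1E]]] :=
    qP L \0 \0 (b0 \o p0) (b1 \o p1).
- by move=> v /=; rewrite linear0 addr0.
- by move=> v /=; rewrite linear0 addr0.
- move=> v; have A := in_ideal_linear b1 (ppsi v).
  have := in_idealN (in_idealD A (bpsi (p0 v))).
  by congr (in_ideal _ _); rewrite /= ?lin; zmod.
- move=> v; have A := in_ideal_linear b0 (pphi v).
  have := in_idealN (in_idealD A (bphi (p1 v))).
  by congr (in_ideal _ _); rewrite /= ?lin; zmod.
pose lin' := (lin, linE i0, linE i1, linE r0, linE r1).
(* A homotopy is odd, hence the shift of [K]; here g is [r i - id] and f is [h q]. *)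
have [|||| e0 [e1 [/= e0E e1E _ _]]] := qP (mf_shift K)
    ((r1 \o i1) \- idfun) ((r0 \o i0) \- idfun) (h1 \o q1) (h0 \o q0).
- move=> v /=; apply: (eq_from_sub (rphi (i1 v))).
  have/eqP := iphi v; rewrite subr_eq0 => /eqP ->.
  by rewrite ?lin'; zmod.
- move=> v /=; apply: (eq_from_sub (rpsi (i0 v))).
  have/eqP := ipsi v; rewrite subr_eq0 => /eqP ->.
  by rewrite ?lin'; zmod.
- move=> v; have A := in_ideal_linear b1 (i1E v).
  have B := in_ideal_linear h0 (qphi v).
  have := in_idealD (in_idealD (in_idealD (r1E (i1 v)) A) (hE1 (q1 v))) B.
  by congr (in_ideal _ _); rewrite /= ?lin'; zmod.
- move=> v; have A := in_ideal_linear b0 (i0E v).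
  have B := in_ideal_linear h1 (qpsi v).
  have := in_idealD (in_idealD (in_idealD (r0E (i0 v)) A) (hE0 (q0 v))) B.
  by congr (in_ideal _ _); rewrite /= ?lin'; zmod.
have {}iphi v : phi L (i1 v) = i0 (phi K v).
  by apply/eqP; rewrite -subr_eq0 iphi.
have {}ipsi v : psi L (i0 v) = i1 (psi K v).
  by apply/eqP; rewrite -subr_eq0 ipsi.
have {}rphi v : phi K (r1 v) = r0 (phi L v).
  by apply/eqP; rewrite -subr_eq0 rphi.
have {}rpsi v : psi K (r0 v) = r1 (psi L v).
  by apply/eqP; rewrite -subr_eq0 rpsi.
apply: (loc_retract P_loc (i := @MkHom R w K L i0 i1 iphi ipsi)
  (r := @MkHom R w L K r0 r1 rphi rpsi)) PY.
exists e1, e0; split=> v /=.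
  by rewrite -e1E ?(linE e0); zmod.
by rewrite -e0E ?(linE e1); zmod.
Qed.
End KoszulLocalizing.

(** * Regular sequences on free modules *)

Section RegularSequences.
Variable R : comNzRingType.
Implicit Types (s : seq R) (V W : lmodType R).

Lemma scale_vector V (v : V) :
  exists L : {linear R^o -> V}, forall r, L r = r *: v.
Proof.
by apply: linear_exists => a b c; rewrite scalerDl scalerA.
Qed.

Lemma in_ideal_scale s V (c : R) (v : V) :
  in_ideal s (c : R^o) -> in_ideal s (c *: v).
Proof. by have [L <-] := scale_vector v; apply: in_ideal_linear. Qed.

Lemma in_ideal_sum s V (I : Type) (r : seq I) (Q : pred I) (F : I -> V) :
  (forall i, Q i -> in_ideal s (F i)) ->
  in_ideal s (\sum_(i <- r | Q i) F i).
Proof.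
by move=> FI; apply: big_ind => //; [apply: in_ideal0 | apply: in_idealD].
Qed.

(** Membership in (s)V is tested on the coordinates, where regularity on R applies. *)
Lemma regular_on_free s V :
  regular_on s R^o -> free_module V -> regular_on s V.
Proof.
move=> sR [I [e eB]]; have [c [_ cP]] := basis_coord eB.
elim: s sR => //= a s IHs [/IHs sV aR]; split=> // v avI.
have [t [ut /(_ t ut (fun=> id)) ->]] := cP v.
apply: in_ideal_sum => i _; apply: in_ideal_scale; apply: aR.
by rewrite -linearZ; apply: in_ideal_linear.
Qed.

Lemma in_ideal_sumP (I : eqType) (x : I -> R) (t : seq I) V (v : V) :
  uniq t -> in_ideal [seq x i | i <- t] v <->
  exists b : I -> V, v = \sum_(i <- t) x i *: b i.
Proof.
elim: t v => [|i t IHt] v /=.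
  move=> _; split=> [->|[b ->]]; last by rewrite big_nil.
  by exists (fun=> 0); rewrite big_nil.
move=> /andP[it ut]; split=> [[u /(IHt _ ut)[b bE]]|[b ->]].
  exists (fun j => if j == i then u else b j); rewrite big_cons eqxx.
  rewrite (eq_big_seq (fun j => x j *: b j)).
    by rewrite -bE [RHS]addrC subrK.
  by move=> j jt; case: eqP => // ji; rewrite -ji jt in it.
exists (b i); apply/IHt => //; exists b.
by rewrite big_cons addrC addKr.
Qed.

(** By regularity of the head x_i, the coefficient b_i is a combination of x_j c_j over the tail.
    Replacing b_j by b_j + x_i c_j gives a shorter relation, and the added terms vanish modulo the
    whole ideal. *)
Lemma regular_independent (I : eqType) (x : I -> R) (t : seq I) V (b : I -> V) :
  uniq t -> regular_on [seq x i | i <- t] V ->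
  \sum_(i <- t) x i *: b i = 0 ->
  forall i, i \in t -> in_ideal [seq x i | i <- t] (b i).
Proof.
elim: t b => //= i t IHt b /andP[it ut] [regt regi] /eqP.
rewrite big_cons addrC addr_eq0 => /eqP bE j.
have bi : in_ideal [seq x i | i <- t] (b i).
  apply: regi; rewrite -[_ *: _]opprK -bE.
  by apply/in_idealN/in_ideal_sumP => //; exists b.
rewrite inE => /orP[/eqP -> | jt]; first exact: (@in_ideal_cons R (x i)) bi.
have [c cE] := (in_ideal_sumP x (b i) ut).1 bi.
exists (- c j); have := IHt (fun j => b j + x i *: c j) ut regt _ j jt.
rewrite scalerN opprK; apply.
under eq_bigr do rewrite scalerDr scalerA mulrC -scalerA.
by rewrite big_split /= -scaler_sumr -cE bE addNr.
Qed.

End RegularSequences.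

(** * Generalized inverses modulo an ideal *)

Section GeneralizedInverse.
Variables (R : comNzRingType) (s : seq R).
Hypothesis residue_field : forall c : R,
  in_ideal s (c : R^o) \/ exists c' : R, c' * c = 1.
Variables (V W : lmodType R) (f : {linear V -> W}).

(* Zorn's lemma is applied to submodules of W x V which contain mW x mV and
   which lift W-elements of [f V + mW] to preimages modulo m; a maximal one
   projects onto W. *)
Let base (p : W * V) : Prop := in_ideal s p.1 /\ in_ideal s p.2.

Let partial (G : W * V -> Prop) : Prop :=
  [/\ forall p, base p -> G p,
      forall a p q, G p -> G q -> G (a *: p + q)
    & forall p v, G p -> in_ideal s (p.1 - f v) -> in_ideal s (f p.2 - p.1)].

Let base_lin a p q : base p -> base q -> base (a *: p + q).
Proof.
by move=> [p1 p2] [q1 q2]; split; apply: in_idealD => //; apply: in_idealZ.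
Qed.

Let base_section p : base p -> in_ideal s (f p.2 - p.1).
Proof.
by case=> p1 p2; apply: in_idealB => //; apply: in_ideal_linear.
Qed.

(** [base] is adjoined to each set in [ok], so that the union of the empty chain qualifies as
    well. *)
Let partial_maximal : exists2 G, partial G & forall H,
  partial H -> (forall p, G p -> H p) -> forall p, H p -> G p.
Proof.
pose ok (A : W * V -> Prop) := partial (fun p => A p \/ base p).
have [|A [Aok Amax]] := @classical_sets.Zorn_bigcup _ ok.
  move=> F Fok Ftot; split=> [p|a p q|p v].
  - by right.
  - case=> [[X FX Xp]|bp] [[Y FY Yq]|bq].
    + have [Z FZ [Zp Zq]] : exists2 Z, F Z & Z p /\ Z q.
        by have [XY|YX] := Ftot _ _ FX FY; [exists Y | exists X] => //;
           split=> //; [apply: XY | apply: YX].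
      have [_ /(_ a p q (or_introl Zp) (or_introl Zq))[Zr|br] _] := Fok _ FZ.
        by left; exists Z.
      by right.
    + have [_ /(_ a p q (or_introl Xp) (or_intror bq))[Zr|br] _] := Fok _ FX.
        by left; exists X.
      by right.
    + have [_ /(_ a p q (or_intror bp) (or_introl Yq))[Zr|br] _] := Fok _ FY.
        by left; exists Y.
      by right.
    + by right; apply: base_lin.
  - case=> [[X FX Xp]|bp _]; last exact: base_section.
    by have [_ _] := Fok _ FX; apply; left.
exists (fun p => A p \/ base p) => // H [Hb Hl Hs] AH p Hp.
apply: contrapT => nAp; apply: (Amax H).
  split=> [q Aq|HA]; first by apply: AH; left.
  by apply: nAp; left; apply: HA.
split=> [q|a q r|q v].
- by right.
- by move=> [Hq|bq] [Hr|br]; left; apply: Hl => //; apply: Hb.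
- by move=> [Hq|bq]; apply: Hs => //; apply: Hb.
Qed.

(** A maximal G is enlarged by the line through (w0, v0). If p.1 + w0 equals f v modulo (s) for some
    p in G, then v0 = v - p.2 works. If there is no such p, then v0 = 0 works: a relation involving
    c w0 with c a unit could be scaled to one with c = 1. *)
Let partial_total G : partial G ->
  (forall H, partial H -> (forall p, G p -> H p) -> forall p, H p -> G p) ->
  forall w0, exists v, G (w0, v).
Proof.
move=> [Gb Gl Gs] Gmax w0.
have G0 : G 0 by apply: Gb; split; apply: in_ideal0.
have GZ a p : G p -> G (a *: p) by move=> Gp; rewrite -[_ *: _]addr0; apply: Gl.
have [v0 v0P] : exists v0 : V, forall p c v, G p ->
    in_ideal s (p.1 + c *: w0 - f v) ->
    in_ideal s (f (p.2 + c *: v0) - (p.1 + c *: w0)).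
  (* For c in (s) the added term is negligible, and the property of G suffices. *)
  have small v0 p c v : in_ideal s (c : R^o) -> G p ->
      in_ideal s (p.1 + c *: w0 - f v) ->
      in_ideal s (f (p.2 + c *: v0) - (p.1 + c *: w0)).
    move=> cI Gp pI.
    have pI' : in_ideal s (f p.2 - p.1).
      apply: (Gs p v Gp); have := in_idealB pI (in_ideal_scale w0 cI).
      by congr (in_ideal _ _); zmod.
    have := in_idealD pI' (in_ideal_scale (f v0 - w0) cI).
    by congr (in_ideal _ _); rewrite (linE f) (linZE f) scalerBr; zmod.
  have [[p [v [Gp pI]]]|no] := pselect (exists p v,
      G p /\ in_ideal s (p.1 + w0 - f v)).
    exists (v - p.2) => q c u Gq qI.
    have A := in_idealB qI (in_idealZ c pI).
    have B : in_ideal s (f (- c *: p + q).2 - (- c *: p + q).1).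
      apply: (Gs _ (u - c *: v) (Gl _ _ _ Gp Gq)); move: A.
      congr (in_ideal _ _); rewrite /= !(linE f, linZE f).
      by rewrite !(scalerBr, scalerDr, scalerN, scaleNr); zmod.
    have := in_idealB B (in_idealZ c pI); congr (in_ideal _ _).
    rewrite /= !(linE f, linZE f) !(scalerBr, scalerDr, scalerN, scaleNr).
    by zmod.
  exists 0 => p c v Gp pI.
  have [cI|[c' c'c]] := residue_field c; first exact: small pI.
  case: no; exists (c' *: p), (c' *: v); split; first exact: GZ.
  have := in_idealZ c' pI; congr (in_ideal _ _).
  by rewrite (linZE f) scalerBr scalerDr scalerA c'c scale1r.
pose H (p : W * V) := exists c q, G q /\ p = q + c *: (w0, v0).
exists v0; apply: (Gmax H).
- split=> [p /Gb Gp|a p q [c [p' [Gp ->]]] [d [q' [Gq ->]]]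
          |p v [c [q [Gq ->]]]].
  + by exists 0, p; rewrite scale0r addr0.
  + exists (a * c + d), (a *: p' + q'); split; first exact: Gl.
    by rewrite scalerDr scalerDl scalerA; zmod.
  + exact: v0P.
- by move=> p Gp; exists 0, p; rewrite scale0r addr0.
by exists 1, 0; rewrite scale1r add0r.
Qed.

(** Freeness of W gives a linear g with graph inside the maximal relation; the latter consists of
    true preimages over the image of f, and f v is in that image. *)
Lemma generalized_inverse : free_module W ->
  exists g : {linear W -> V}, forall v, in_ideal s (f (g (f v)) - f v).
Proof.
have [G Gok Gmax] := partial_maximal.
move=> freeW; have Gtot := partial_total Gok Gmax.
have [Gb Gl Gs] := Gok.
have [||g gP] := free_section (Q := fun v w => G (v, w)) freeW.
- split; first by apply: Gb; split; apply: in_ideal0.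
  by move=> a v u v' u'; apply: Gl.
- exact: Gtot.
exists g => v; apply: (Gs (f v, g (f v)) v) => //=.
by rewrite subrr; apply: in_ideal0.
Qed.
End GeneralizedInverse.

(** * Null-homotopic scalars *)

Section LocalRings.
Variable R : comNzRingType.

Lemma mem_take_enum_ord n l (i : 'I_n) :
  (i \in rev (take l (enum 'I_n))) = (i < l)%N.
Proof. by rewrite mem_rev in_take ?mem_enum // index_enum_ord. Qed.

(** The reversed prefixes match [regular_on], which peels off the last element first. *)
Lemma in_ideal_ideal_span n (x : 'I_n -> R) l (r : R^o) :
  in_ideal [seq x i | i <- rev (take l (enum 'I_n))] r
  <-> ideal_span (fun j : 'I_n => (j < l)%N) x r.
Proof.
have ut : uniq (rev (take l (enum 'I_n))).
  by rewrite rev_uniq take_uniq ?enum_uniq.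
have sumE (b : 'I_n -> R^o) : \sum_(i <- rev (take l (enum 'I_n))) x i *: b i
    = \sum_(i < n | (i < l)%N) b i * x i.
  rewrite big_uniq //; apply: eq_big => [i|i _]; last exact: mulrC.
  exact: mem_take_enum_ord.
rewrite in_ideal_sumP //; split=> -[b ->]; exists b; first exact: sumE.
by rewrite sumE.
Qed.

Lemma regular_sequence_regular_on n (x : 'I_n -> R) :
  regular_sequence x -> regular_on [seq x i | i <- rev (enum 'I_n)] R^o.
Proof.
move=> [xreg _].
suff H l : (l <= n)%N ->
    regular_on [seq x i | i <- rev (take l (enum 'I_n))] R^o.
  by have := H n (leqnn n); rewrite take_oversize ?size_enum_ord.
elim: l => [|l IHl] ln; first by rewrite take0.
pose i := Ordinal ln.
have -> : take l.+1 (enum 'I_n) = rcons (take l (enum 'I_n)) i.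
  rewrite (take_nth i) ?size_enum_ord //; congr rcons.
  by apply: val_inj; rewrite /= nth_enum_ord.
rewrite rev_rcons /=; split=> [|r /in_ideal_ideal_span]; first exact/IHl/ltnW.
by move=> /(xreg i) H; apply/in_ideal_ideal_span.
Qed.

(** Zorn's lemma for proper ideals containing c. The multiples of c are adjoined to every member to
    cover the empty chain, and the result is made boolean classically. *)
Lemma maximal_ideal_exists (c : R) : (forall c' : R, c' * c <> 1) ->
  exists M : {pred R}, maximal_ideal M /\ c \in M.
Proof.
move=> cN; pose base (r : R) := exists a : R, r = a * c.
pose ideal (A : R -> Prop) :=
  [/\ forall r, base r -> A r, ~ A 1
    & forall a u v, A u -> A v -> A (a * u + v)].
pose ok (A : R -> Prop) := ideal (fun r => A r \/ base r).
have base_lin a u v : base u -> base v -> base (a * u + v).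
  by move=> [b ->] [d ->]; exists (a * b + d); rewrite mulrDl mulrA.
have [F Fok Ftot|A [[_ A1 Al] Amax]] := @classical_sets.Zorn_bigcup R ok.
  split=> [r br|[[X FX X1]|[a a1]]|a u v]; first by right.
  - by have [_ + _] := Fok _ FX; apply; left.
  - exact: (cN a).
  case=> [[X FX Xu]|bu] [[Y FY Yv]|bv].
  - have [Z FZ [Zu Zv]] : exists2 Z, F Z & Z u /\ Z v.
      by have [XY|YX] := Ftot _ _ FX FY; [exists Y | exists X] => //;
         split=> //; [apply: XY | apply: YX].
    have [_ _ /(_ a u v (or_introl Zu) (or_introl Zv))[Zr|br]] := Fok _ FZ.
      by left; exists Z.
    by right.
  - have [_ _ /(_ a u v (or_introl Xu) (or_intror bv))[Zr|br]] := Fok _ FX.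
      by left; exists X.
    by right.
  - have [_ _ /(_ a u v (or_intror bu) (or_introl Yv))[Zr|br]] := Fok _ FY.
      by left; exists Y.
    by right.
  - by right; apply: base_lin.
pose M : {pred R} := fun r => `[< A r \/ base r >].
have ME r : r \in M <-> A r \/ base r.
  by split=> [/asboolP|?]; last apply/asboolP.
have cM : c \in M by apply/ME; right; exists 1; rewrite mul1r.
exists M; split=> //; split.
  split; first by apply/ME; right; exists 0; rewrite mul0r.
    by apply/negP => /ME.
  by move=> a u v /ME Mu /ME Mv; apply/ME/Al.
move=> I [I0 I1 Il] MI r; apply/idP/idP; last exact: MI.
move=> Ir; apply: contrapT => Mr; apply: (Amax (fun r => r \in I)).
  split=> [q Aq|IA]; first by apply/MI/ME; left.
  by apply: Mr; apply/ME; left; apply: IA.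
have bI q : base q -> q \in I by move=> bq; apply/MI/ME; right.
split=> [q bq|[|/bI]|a u v uI vI]; [by right | exact/negP | exact/negP | left].
by apply: Il; [case: uI => // /bI | case: vI => // /bI].
Qed.

Lemma local_ring_unit (m : {pred R}) (c : R) :
  local_ring m -> c \notin m -> exists c' : R, c' * c = 1.
Proof.
move=> [_ m_unique]; apply: contraNP => cN.
have [|M [/m_unique Mm cM]] := maximal_ideal_exists (c := c).
  by move=> c' c'c; apply: cN; exists c'.
by rewrite -Mm.
Qed.

End LocalRings.

Section Derivations.
Variables (R : comNzRingType) (D : R -> R).
Hypothesis DD : forall a b, D (a + b) = D a + D b.
Hypothesis DM : forall a b, D (a * b) = D a * b + a * D b.

Let D0 : D 0 = 0.
Proof. by apply: (addrI (D 0)); rewrite -DD !addr0. Qed.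

(* [nabla] differentiates the coordinates in a basis. *)
Lemma free_connection (V : lmodType R) : free_module V ->
  exists nabla : V -> V, (forall u v, nabla (u + v) = nabla u + nabla v) /\
    forall a v, nabla (a *: v) = D a *: v + a *: nabla v.
Proof.
move=> [I [e eB]]; have [c [cE cP]] := basis_coord eB.
have [s sP] := choice cP.
have csupp v i : i \notin s v -> c i v = 0.
  have [us /(_ _ us (fun=> id)) vE] := sP v.
  move=> si; rewrite vE linear_sum big1_seq // => j /andP[_ js].
  rewrite linearZ /= cE; case: eqP => [ij|]; last by rewrite scaler0.
  by rewrite ij js in si.
pose nabla v := \sum_(i <- s v) D (c i v) *: e i.
(* Enlarging the support changes nothing, since coordinates outside it vanish and D 0 = 0. *)
have nablaE v t : uniq t -> {subset s v <= t} ->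
    nabla v = \sum_(i <- t) D (c i v) *: e i.
  move=> ut st; rewrite /nabla (sum_extend _ _ (sP v).1 ut st).
  apply: eq_bigr => i _; congr (_ *: _).
  by case: ifP => // /negbT/csupp ->.
exists nabla; split=> [u v|a v].
  pose t := undup (s u ++ s v ++ s (u + v)).
  have ut : uniq t by exact: undup_uniq.
  rewrite (nablaE u t) ?(nablaE v t) ?(nablaE (u + v) t) //.
  - by rewrite -big_split; apply: eq_bigr => i _; rewrite linearD DD scalerDl.
  - by move=> i si; rewrite mem_undup !mem_cat si !orbT.
  - by move=> i si; rewrite mem_undup !mem_cat si !orbT.
  - by move=> i si; rewrite mem_undup !mem_cat si.
pose t := undup (s v ++ s (a *: v)).
have ut : uniq t by exact: undup_uniq.
have sv : {subset s v <= t} by move=> i si; rewrite mem_undup mem_cat si.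
rewrite (nablaE v t) ?(nablaE (a *: v) t) //; last first.
  by move=> i si; rewrite mem_undup mem_cat si orbT.
rewrite {2}((sP v).2 t ut sv) !scaler_sumr -big_split; apply: eq_bigr => i _.
by rewrite linearZ /= DM scalerDl !scalerA.
Qed.

(* The commutator of [nabla] with the differential [d] is linear, and
   [[nabla, d^2] = [nabla, w] = D w]. *)
Lemma null_scalar_derivation (w : R) : null_scalar w (D w).
Proof.
move=> X; have [n0 [n0D n0Z]] := free_connection (mf0_free X).
have [n1 [n1D n1Z]] := free_connection (mf1_free X).
pose lin := (linE (phi X), linE (psi X), linZE (phi X), linZE (psi X),
  n0D, n1D, n0Z, n1Z).
have [|h0 h0E] := @linear_exists _ _ _ (fun v => n1 (psi X v) - psi X (n0 v)).
  by move=> a u v; rewrite !lin scalerBr; zmod.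
have [|h1 h1E] := @linear_exists _ _ _ (fun v => n0 (phi X v) - phi X (n1 v)).
  by move=> a u v; rewrite !lin scalerBr; zmod.
exists h0, h1; split=> v; rewrite /= /hom_scale_fun h0E h1E.
  by rewrite !lin !phi_psi !lin; zmod.
by rewrite !lin !psi_phi !lin; zmod.
Qed.

End Derivations.

Section IsolatedSingularity.
Variables (k : fieldType) (R : comAlgType k).

Lemma kernel_vector d (C : 'M[k]_(d.+1, d)) :
  exists2 u : 'rV[k]_d.+1, u != 0 & u *m C = 0.
Proof.
have /rowV0Pn[u /sub_kermxP uC u0] : kermx C != 0.
  rewrite kermx_eq0 /row_free neq_ltn ltnS (leq_trans (rank_leq_col C)) //.
by exists u.
Qed.

(** Modulo the ideal J of null scalars, R is spanned by d elements over k, so 1, y, ..., y^d satisfy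
    a nontrivial relation in R / J. With j its least exponent, it reads (u_j + y z) y^j, where the
    first factor is a unit because y is in m. *)
Lemma isolated_null_power (m : {pred R}) (w : R) n (y : R) :
  local_ring m -> isolated_singular_locus w n -> y \in m ->
  exists N, null_scalar w (y ^+ N).
Proof.
move=> Rloc [D [DD [d [b bP]]]] ym.
pose J := null_scalar w.
have JN r : J r -> J (- r) by rewrite -mulN1r; apply: null_scalarM.
have /choice[c cP] : forall r, exists c : 'I_d -> k, J (r - \sum_j c j *: b j).
  move=> r; have [c [a0 [a ->]]] := bP r; exists c.
  rewrite addrC addKr; apply: null_scalarD.
    exact/null_scalarM/null_scalar_w.
  apply: null_scalar_sum => i; apply: null_scalar_derivation.
    by move=> u v; rewrite linearD.
  exact: DD.
have [u u0 uC] := kernel_vector (\matrix_(j < d.+1, i < d) c (y ^+ j) i).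
have Ju : J (\sum_(j < d.+1) u 0 j *: y ^+ j).
  (* The subtracted combinations of the [b i] sum to 0 by [uC], and each remaining bracket lies in
     J. *)
  have -> : \sum_(j < d.+1) u 0 j *: y ^+ j
      = \sum_(j < d.+1) (u 0 j)%:A * (y ^+ j - \sum_i c (y ^+ j) i *: b i).
    under [RHS]eq_bigr do rewrite mulr_algl scalerBr scaler_sumr.
    rewrite sumrB [X in _ - X](_ : _ = 0) ?subr0 //.
    rewrite exchange_big big1 // => i _.
    have /rowP/(_ i) := uC; rewrite !mxE => uCi.
    rewrite -[RHS](scale0r (b i)) -uCi scaler_suml; apply: eq_bigr => j _.
    by rewrite mxE scalerA.
  by apply: null_scalar_sum => j; apply: cP.
have [j0 uj0] : exists j, u 0 j != 0.
  by apply/existsP; apply: contraNT u0 => /existsPn H; apply/eqP/rowP => j;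
     rewrite mxE; apply/eqP; have := H j; rewrite negbK.
pose j := [arg min_(i < j0 | u 0 i != 0) i].
have [uj jmin] : u 0 j != 0 /\ forall i, u 0 i != 0 -> (j <= i)%N.
  by rewrite /j; case: arg_minnP => // i ui imin.
have [z zE] : exists z : R, \sum_(j < d.+1) u 0 j *: y ^+ j
    = (((u 0 j)%:A + y * z) * y ^+ j).
  exists (\sum_(i < d.+1 | (j < i)%N) u 0 i *: y ^+ (i - j).-1).
  rewrite (bigID (fun i : 'I_d.+1 => (j <= i)%N)) /= [X in _ + X]big1 ?addr0.
    rewrite (bigD1 j) //= mulrDl mulr_algl; congr (_ + _).
    rewrite -mulrA mulr_suml mulr_sumr; apply: eq_big => [i|i].
      by rewrite ltn_neqAle andbC -val_eqE eq_sym.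
    move=> /andP[le_ji neq_ij]; have lt_ji : (j < i)%N.
      by rewrite ltn_neqAle le_ji eq_sym val_eqE neq_ij.
    rewrite -scalerAl -scalerAr -exprD -exprS; congr (_ *: _ ^+ _).
    by rewrite -addSn prednK ?subn_gt0 // subnK.
  move=> i ji; rewrite (_ : u 0 i = 0) ?scale0r //; apply/eqP.
  by apply: contraNT ji; apply: jmin.
have [|e eE] := @local_ring_unit R m ((u 0 j)%:A + y * z) Rloc.
  (* Otherwise the nonzero constant u_j, and with it 1, would lie in m. *)
  apply/negP => cm; case: Rloc => [[[m0 /negP m1 ml] _] _]; apply: m1.
  have um : (u 0 j)%:A \in m.
    rewrite (_ : _%:A = - z * y + ((u 0 j)%:A + y * z)); first exact: ml.
    by rewrite mulNr mulrC; zmod.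
  have := ml (u 0 j)^-1%:A _ _ um m0.
  by rewrite addr0 mulr_algl scalerA mulVf // scale1r.
exists j; rewrite -[y ^+ j]mul1r -eE -mulrA -zE.
exact: null_scalarM.
Qed.

End IsolatedSingularity.

(** * Comparison with copies of the Koszul factorization *)

Section HomologyProjection.
Variables (R : comNzRingType) (w : R) (s : seq R) (X : MF w).
Hypothesis w_in_s : in_ideal s (w : R^o).

(* Modulo [s], [p] factors through the homology of X / sX. *)
Definition homology_proj (p0 : {linear mf0 X -> mf0 X})
    (p1 : {linear mf1 X -> mf1 X}) (h0 : {linear mf0 X -> mf1 X})
    (h1 : {linear mf1 X -> mf0 X}) : Prop :=
  [/\ (forall v, in_ideal s (phi X (p1 v))) /\
      (forall v, in_ideal s (psi X (p0 v))),
      (forall v, in_ideal s (p0 (phi X v))) /\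
      (forall v, in_ideal s (p1 (psi X v))),
      forall v, in_ideal s (p0 v - v - (phi X (h0 v) + h1 (psi X v)))
    & forall v, in_ideal s (p1 v - v - (psi X (h1 v) + h0 (phi X v)))].

(** With g a generalized inverse of d modulo (s), take p = id - (d g + g d). Since d^2 = w lies in
    (s), both d p and p d reduce to d - d g d, which vanishes there. *)
Lemma homology_proj_exists :
  (forall c : R, in_ideal s (c : R^o) \/ exists c' : R, c' * c = 1) ->
  exists p0 p1 h0 h1, homology_proj p0 p1 h0 h1.
Proof.
move=> field_s.
have [g0 g0P] := generalized_inverse field_s (phi X) (mf0_free X).
have [g1 g1P] := generalized_inverse field_s (psi X) (mf1_free X).
exists (idfun \- ((phi X \o g0) \+ (g1 \o psi X))).
exists (idfun \- ((psi X \o g1) \+ (g0 \o phi X))).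
exists (\- g0), (\- g1).
pose lin := (linE (phi X), linE (psi X), linE g0, linE g1).
split.
- split=> v.
    have := in_idealN (in_idealD (g0P v) (in_ideal_scale (g1 v) w_in_s)).
    by congr (in_ideal _ _); rewrite -phi_psi /= !lin; zmod.
  have := in_idealN (in_idealD (g1P v) (in_ideal_scale (g0 v) w_in_s)).
  by congr (in_ideal _ _); rewrite -psi_phi /= !lin; zmod.
- split=> v.
    have := in_idealN (in_idealD (g0P v) (in_ideal_scale (g1 v) w_in_s)).
    by congr (in_ideal _ _); rewrite /= psi_phi (linZE g1); zmod.
  have := in_idealN (in_idealD (g1P v) (in_ideal_scale (g0 v) w_in_s)).
  by congr (in_ideal _ _); rewrite /= phi_psi (linZE g0); zmod.
- move=> v; have := in_ideal0 s (mf0 X).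
  by congr (in_ideal _ _); rewrite /= !lin; zmod.
- move=> v; have := in_ideal0 s (mf1 X).
  by congr (in_ideal _ _); rewrite /= !lin; zmod.
Qed.

(** In [homology_proj_scale] it is the square of p that each w_i kills, so p is exchanged for its
    square. The homotopy combines [p p] to p with p to the identity. *)
Lemma homology_proj_sqr p0 p1 h0 h1 : homology_proj p0 p1 h0 h1 ->
  homology_proj (p0 \o p0) (p1 \o p1) ((h0 \o p0) \+ h0) ((h1 \o p1) \+ h1).
Proof.
move=> [[dp0 dp1] [pd0 pd1] hE0 hE1]; split.
- by split=> v; [apply: dp0 | apply: dp1].
- by split=> v /=; [exact: (in_ideal_linear p0 (pd0 v))
               | exact: (in_ideal_linear p1 (pd1 v))].
- move=> v; have A := in_ideal_linear h1 (dp1 v).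
  have B := in_ideal_linear h1 (pd1 v).
  have := in_idealB (in_idealD (in_idealD (hE0 (p0 v)) (hE0 v)) A) B.
  by congr (in_ideal _ _); rewrite /= (linE (phi X)); zmod.
- move=> v; have A := in_ideal_linear h0 (dp0 v).
  have B := in_ideal_linear h0 (pd0 v).
  have := in_idealB (in_idealD (in_idealD (hE1 (p1 v)) (hE1 v)) A) B.
  by congr (in_ideal _ _); rewrite /= (linE (psi X)); zmod.
Qed.

End HomologyProjection.

(* If [d (p v) = \sum_i x_i a_i], then [w p v = \sum_i x_i (d a_i)], so that
   [w_i p v - d a_i] vanishes modulo [x] as [x] is regular; now apply [p]. *)
Lemma homology_proj_scale (R : comNzRingType) (w : R) (X : MF w) (I : eqType)
    (x ww : I -> R) (t : seq I) p0 p1 h0 h1 :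
  uniq t -> w = \sum_(i <- t) x i * ww i ->
  regular_on [seq x i | i <- t] (mf0 X) ->
  regular_on [seq x i | i <- t] (mf1 X) ->
  @homology_proj R w [seq x i | i <- t] X p0 p1 h0 h1 ->
  forall i, i \in t ->
    (forall v, in_ideal [seq x i | i <- t] (ww i *: p0 (p0 v))) /\
    (forall v, in_ideal [seq x i | i <- t] (ww i *: p1 (p1 v))).
Proof.
move=> ut wE reg0 reg1 [[dp0 dp1] [pd0 pd1] _ _] i it; split=> v.
  have [a aE] := (in_ideal_sumP _ _ ut).1 (dp1 v).
  have ai : in_ideal [seq x i | i <- t] (ww i *: p0 v - phi X (a i)).
    apply: (regular_independent (b := fun i => ww i *: p0 v - phi X (a i)) ut
      reg0 _ it).
    under eq_bigr do rewrite scalerBr scalerA -(linZE (phi X)).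
    rewrite sumrB -linear_sum -aE phi_psi -scaler_suml -wE subrr //.
  have := in_idealD (in_ideal_linear p0 ai) (pd0 (a i)).
  by congr (in_ideal _ _); rewrite !(linE p0, linZE p0); zmod.
have [a aE] := (in_ideal_sumP _ _ ut).1 (dp0 v).
have ai : in_ideal [seq x i | i <- t] (ww i *: p1 v - psi X (a i)).
  apply: (regular_independent (b := fun i => ww i *: p1 v - psi X (a i)) ut
    reg1 _ it).
  under eq_bigr do rewrite scalerBr scalerA -(linZE (psi X)).
  by rewrite sumrB -linear_sum -aE psi_phi -scaler_suml -wE subrr.
have := in_idealD (in_ideal_linear p1 ai) (pd1 (a i)).
by congr (in_ideal _ _); rewrite !(linE p1, linZE p1); zmod.
Qed.

Section KoszulGenerator.
Variables (R : comNzRingType) (n : nat) (x ww : 'I_n -> R).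

Let even0 : odd #|set0 : {set 'I_n}| == false.
Proof. by rewrite cards0. Qed.

Definition ext_one : ext_part R n false := [ffun A => (val A == set0)%:R].
Definition ext_gen (l : 'I_n) : ext_part R n true :=
  [ffun A => (val A == [set l])%:R].
Definition ext_aug (f : ext_part R n false) : R^o :=
  f (exist _ set0 even0).

Fact ext_aug_linear : linear ext_aug.
Proof. by move=> a f g; rewrite /ext_aug !ffunE. Qed.
HB.instance Definition _ :=
  GRing.isLinear.Build R _ _ _ ext_aug ext_aug_linear.

Lemma ext_aug_one : ext_aug ext_one = 1.
Proof. by rewrite /ext_aug ffunE eqxx. Qed.

(** Only the contraction reaches degree zero, and its coefficients are multiples of the x_i. *)
Lemma ext_aug_koszul_d (f : ext_part R n true) :
  in_ideal [seq x i | i <- rev (enum 'I_n)]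
    (ext_aug (@koszul_d R n x ww true f)).
Proof.
rewrite /ext_aug ffunE /koszul_full /contraction /ext_mul /=.
rewrite [X in _ + X]big1 ?addr0; last by move=> i; rewrite inE.
apply: (@in_ideal_sum R _ R^o) => i _; rewrite mulrAC mulrC.
by apply: in_ideal_mem; rewrite map_f // mem_rev mem_enum.
Qed.

Lemma koszul_d_one : @koszul_d R n x ww false ext_one
  = \sum_l ww l *: ext_gen l.
Proof.
have oneE A : ext_coord ext_one A = (A == set0)%:R.
  rewrite /ext_coord; case: insubP => [B _ <-|]; first by rewrite ffunE.
  by have [->|//] := eqVneq A set0; rewrite even0.
apply/ffunP => A; rewrite sum_ffunE ffunE /koszul_full /contraction.
rewrite big1 ?add0r => [|i _]; last first.
  rewrite oneE (_ : i |: _ == set0 = false) ?mulr0 //.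
  by apply/negbTE/set0Pn; exists i; rewrite setU11.
rewrite /ext_mul [RHS](bigID (fun i => i \in val A)) /= [X in _ = _ + X]big1.
  rewrite addr0; apply: eq_bigr => i iA; rewrite oneE !ffunE.
  have -> : (val A :\ i == set0) = (val A == [set i]).
    apply/eqP/eqP => [A0|->]; last by rewrite setDv.
    by transitivity (i |: (val A :\ i)); [rewrite setD1K | rewrite A0 setU0].
  have [->|_] := eqVneq; last by rewrite mulr0 scaler0.
  rewrite /ksign (_ : [set j in _ | _] = set0) ?cards0 ?expr0 ?mul1r //.
  by apply/setP => j; rewrite !inE; case: eqP => // ->; rewrite ltnn.
move=> i iA; rewrite !ffunE; case: eqP => [Ai|]; last by rewrite scaler0.
by rewrite Ai set11 in iA.
Qed.

End KoszulGenerator.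

Lemma in_ideal_pair (R : comNzRingType) (s : seq R) (U V : lmodType R)
    (p : (U * V)%type) :
  in_ideal s p.1 -> in_ideal s p.2 -> in_ideal s p.
Proof.
pose i1 : {linear U -> (U * V)%type} := pair_map idfun \0.
pose i2 : {linear V -> (U * V)%type} := pair_map \0 idfun.
move=> /(in_ideal_linear i1) I1 /(in_ideal_linear i2) I2.
have := in_idealD I1 I2; congr (in_ideal _ _).
by apply: pair_ext; rewrite /= ?addr0 ?add0r.
Qed.

Lemma dsum_in_ideal (R : comNzRingType) (s : seq R) (I : choiceType)
    (V : I -> lmodType R) (W : lmodType R) (L : {linear dsum V -> W}) :
  (forall i v, in_ideal s (L (@dsum_inj R I V i v))) ->
  forall u, in_ideal s (L u).
Proof.
move=> LI u; have [t [ut tu]] := dsum_uniq_support u.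
by rewrite (dsum_sum ut tu) linear_sum; apply: in_ideal_sum => i _.
Qed.

Section KoszulCopies.
Variables (R : comNzRingType) (n : nat) (x ww : 'I_n -> R) (w : R).
Hypothesis w_def : w = \sum_i x i * ww i.

Let s := [seq x i | i <- rev (enum 'I_n)].
Let K := koszul_mf w_def.

(** [A] sends e_i to the unit 1 of the i-th copy of K, and [B] is the augmentation on each copy. As
    d 1 is the sum of the w_l e_l, the vector d (A v) depends only on the multiples w_l v. *)
Lemma koszul_copies (V : lmodType R) (I : choiceType) (e : I -> V) :
  basis e -> let Y := mf_dsum (fun _ : I => K) in
  exists (A : {linear V -> mf0 Y}) (B : {linear mf0 Y -> V}),
    [/\ forall v, B (A v) = v,
        forall u, in_ideal s (B (phi Y u))
      & forall v, (forall l, in_ideal s (ww l *: v)) ->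
          in_ideal s (psi Y (A v))].
Proof.
move=> eB Y.
have [A AE] := basis_lift
  (fun i => @dsum_inj R I (fun _ => mf0 K) i (ext_one R n)) eB.
have /(_ _)/cid-/all_sig[E EE] i := scale_vector (e i).
have [B BE] := @dsum_lift R I (fun _ => mf0 K) V (fun i => E i \o @ext_aug R n).
exists A, B; split.
- apply: (basis_ext (L := B \o A) (L' := idfun) eB) => i /=.
  by rewrite AE BE /= ext_aug_one EE scale1r.
- apply: (dsum_in_ideal (L := B \o phi Y)) => i u /=.
  rewrite dsum_map_inj BE /=; apply: in_ideal_linear.
  exact: ext_aug_koszul_d.
(* [C l] sends e_i to the exterior generator e_l of the i-th copy. *)
have /choice[C CE] l := basis_lift
  (fun i => @dsum_inj R I (fun _ => mf1 K) i (ext_gen R l)) eB.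
move=> v vI; rewrite (_ : psi Y (A v) = \sum_l C l (ww l *: v)).
  by apply: in_ideal_sum => l _; apply: in_ideal_linear.
have [L LE] : exists L : {linear V -> mf1 Y}, forall v,
    L v = \sum_l C l (ww l *: v).
  apply: linear_exists => a u u'; rewrite scaler_sumr -big_split.
  apply: eq_bigr => l _ /=; rewrite -!(linZE (C l)) -linearD.
  by congr (C l _); rewrite scalerDr !scalerA mulrC.
rewrite -LE; move: v {vI}; apply: (basis_ext (L := psi Y \o A) eB) => i.
rewrite LE /= AE dsum_map_inj /= koszul_d_one linear_sum.
by apply: eq_bigr => l _; rewrite !linearZ /= CE.
Qed.

Variable P : MF w -> Prop.
Hypothesis P_loc : localizing P.

(** X is compared with a sum Y of copies of K and K[1] through a = A p and b = p B. As B A = id, the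
    composite b a is [p p], homotopic to the identity modulo (s). *)
Lemma loc_kos_koszul (X : MF w) :
  regular_on s R^o ->
  (forall c : R, in_ideal s (c : R^o) \/ exists c' : R, c' * c = 1) ->
  P K -> P (kos s X).
Proof.
move=> sreg field_s PK.
have [I0 [e0 e0B]] := mf0_free X; have [I1 [e1 e1B]] := mf1_free X.
have [A0 [B0 [BA0 B0I A0I]]] := koszul_copies e0B.
have [A1 [B1 [BA1 B1I A1I]]] := koszul_copies e1B.
set Y0 := mf_dsum _ in A0 B0 BA0 B0I A0I.
set Y1 := mf_dsum _ in A1 B1 BA1 B1I A1I.
(* The cone of the zero map is the direct sum of Y0 and Y1[1]; Y0 serves the even part of X, Y1[1]
   the odd part. *)
pose Y := mf_cone (hom_zero Y1 Y0).
have PY : P Y by apply: loc_cone => //; apply: loc_dsum.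
have reg (V : lmodType R) : free_module V -> regular_on s V.
  exact: regular_on_free.
have ut : uniq (rev (enum 'I_n)) by rewrite rev_uniq enum_uniq.
have wE : w = \sum_(i <- rev (enum 'I_n)) x i * ww i.
  rewrite [LHS]w_def [RHS]big_uniq //; apply: eq_bigl => i.
  by rewrite mem_rev mem_enum.
have ws : in_ideal s (w : R^o) by apply/in_ideal_sumP => //; exists ww.
have [q0 [q1 [g0 [g1 qP]]]] := homology_proj_exists X ws field_s.
have qw := homology_proj_scale ut wE
  (reg _ (mf0_free X)) (reg _ (mf1_free X)) qP.
have {qP} pP := homology_proj_sqr qP.
set p0 : {linear _ -> _} := q0 \o q0 in pP.
set p1 : {linear _ -> _} := q1 \o q1 in pP.
have [[dp0 dp1] [pd0 pd1] _ _] := pP.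
have [h0 [h1 [hE0 hE1]]] : exists (h0 : {linear mf0 X -> mf1 X})
    (h1 : {linear mf1 X -> mf0 X}),
    (forall v, in_ideal s (p0 (p0 v) - v - (phi X (h0 v) + h1 (psi X v)))) /\
    (forall v, in_ideal s (p1 (p1 v) - v - (psi X (h1 v) + h0 (phi X v)))).
  by have [_ _ hE0 hE1] := homology_proj_sqr pP; do 2!eexists; split;
     [exact: hE0 | exact: hE1].
have w0 v l : in_ideal s (ww l *: p0 v).
  by apply: (qw l _).1; rewrite mem_rev mem_enum.
have w1 v l : in_ideal s (ww l *: p1 v).
  by apply: (qw l _).2; rewrite mem_rev mem_enum.
(* Modulo (s), [a] is closed because p d and all w_l p vanish, and [b] because d p and B d
   vanish. *)
pose a0 : {linear mf0 X -> mf0 Y} := pair_map (A0 \o p0) \0.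
pose a1 : {linear mf1 X -> mf1 Y} := pair_map \0 (A1 \o p1).
pose b0 : {linear mf0 Y -> mf0 X} := p0 \o (B0 \o fst).
pose b1 : {linear mf1 Y -> mf1 X} := p1 \o (B1 \o snd).
apply: (@loc_kos_retract _ _ _ P_loc s X Y a0 a1 b0 b1 h0 h1);
  try exact/reg/mf0_free; try exact/reg/mf1_free; try exact: PY.
- split=> v; apply: in_ideal_pair; rewrite /= ?(linE, subr0, sub0r, addr0).
  + exact: (in_idealN (in_ideal_linear A0 (pd0 v))).
  + by apply: in_idealN; apply: A1I => l; apply: w1.
  + by apply: A0I => l; apply: w0.
  + exact: (in_idealN (in_ideal_linear A1 (pd1 v))).
- split=> v /=.
    apply: (in_idealB (dp0 (B1 v.2))).
    by rewrite addr0; do 2!apply: in_ideal_linear; apply: B0I.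
  apply: (in_idealB (dp1 (B0 v.1))).
  rewrite !(linE B1, linE q1); apply: in_idealN.
  by do 2!apply: in_ideal_linear; apply: B1I.
- by move=> v; rewrite /= BA0; exact: hE0.
- by move=> v; rewrite /= BA1; exact: hE1.
Qed.
End KoszulCopies.

Theorem theorem4p1 (k : fieldType) (R : comAlgType k) (m : {pred R}) (n : nat)
    (w : R)
    (R_regular : regular_local_ring m n)
    (R_residue : has_residue_field m)
    (w_in_m : w \in m) (w_neq0 : w <> 0)
    (w_isolated : isolated_singular_locus w n)
    (x ww : 'I_n -> R)
    (x_regular : regular_sequence x) (x_gen : generates x m)
    (w_def : w = \sum_i x i * ww i) :
  compact_generator (koszul_mf w_def).
Proof.
have [_ R_local _ _] := R_regular.
have mE (r : R^o) : r \in m <-> in_ideal [seq x i | i <- rev (enum 'I_n)] r.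
  rewrite x_gen -[enum _]take_size size_enum_ord in_ideal_ideal_span.
  by split=> -[a ->]; exists a; apply: eq_bigl => i; rewrite ltn_ord.
split; first by apply: finite_rank_compact; apply: ffun_finitely_generated.
move=> P P_loc PK X.
apply: (loc_of_kos P_loc (s := [seq x i | i <- rev (enum 'I_n)])).
  move=> _ /mapP[i _ ->]; apply: isolated_null_power R_local w_isolated _.
  by apply/mE; rewrite -[x i]mulr1; apply: (@in_ideal_mem _ _ _ R^o);
     rewrite map_f // mem_rev mem_enum.
apply: (@loc_kos_koszul R n x ww w w_def P P_loc X _ _ PK).
  exact: regular_sequence_regular_on.
(* Elements outside m are units in a local ring, so R / (x) is a field. *)
move=> c; have [cm|cNm] := boolP (c \in m); first by left; apply/mE.
by right; apply: local_ring_unit R_local cNm.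
Qed.
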